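(* Let $f$ be a real-valued measurable function defined on $[0,1)$ and extended periodically to $\mathbb{R}$ by $f(x+1)=f(x)$, such that for some constants $h$ and $\alpha>0$ $$|f(x)-f(y)|\le h|x-y|^\alpha\ \ (x\ne y),\qquad \int_0^1 f(x)\,dx=0,\qquad \int_0^1 f^2(x)\,dx=1.$$ Let $(m_k)_{k\in\mathbb{N}}$ be an increasing sequence of (positive) integers such that $b_k:=\frac{m_{k+1}}{m_k}\in\{2,3,\dots\}$ for all $k$ and $b_k\to\infty$ as $k\to\infty$. Let $(a_{k,n})_{1\le k\le n}$ be a triangular array of real numbers such that, as $n\to\infty$, $$A_n:=\Big(\sum_{k=1}^n a_{k,n}^2\Big)^{1/2}\to\infty,\qquad \sum_{k=1}^n|a_{k,n}|^3\to 0,\qquad A_n\sum_{k=1}^n\frac{|a_{k,n}|}{b_k^\alpha}\to 0 .$$ Let $S_n^{\mathrm H}(x)=\sum_{k=1}^n a_{k,n}f(m_kx)$. Then for every bounded Jordan measurable set $B\subset\mathbb{R}$, $$A_n\,\big|\{x\in[0,1]:\ S_n^{\mathrm H}(x)\in B\}\big|\ \longrightarrow\ \frac{1}{\sqrt{2\pi}}\,|B|\qquad(n\to\infty).$$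
   Context: $|\cdot|$ of a set denotes Lebesgue measure. *)

(* Defs.v *)
From HB Require Import structures.
From mathcomp Require Export all_boot all_order all_algebra.
From mathcomp Require Export all_classical all_reals all_analysis.

Set Implicit Arguments.
Unset Strict Implicit.
Unset Printing Implicit Defensive.

Export Order.TTheory GRing.Theory Num.Theory.
Export numFieldNormedType.Exports.

Local Open Scope classical_set_scope.
Local Open Scope ring_scope.

(* On an arbitrary set, [lebesgue_measure] is the Lebesgue outer measure; on
   Lebesgue measurable sets (Borel or not) it is the usual Lebesgue measure. *)

(* A finite union of bounded intervals (open, closed, half-open, degenerate). *)
Definition elementary_set (R : realType) (E : set R) : Prop :=
  exists2 s : seq (interval R),
    (forall i, i \in s -> bounded_set [set` i]) &
    E = [set x | exists2 i, i \in s & x \in i].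

Definition inner_jordan_content (R : realType) (B : set R) : \bar R :=
  ereal_sup [set lebesgue_measure E | E in
    [set E : set R | elementary_set E /\ E `<=` B]].

Definition outer_jordan_content (R : realType) (B : set R) : \bar R :=
  ereal_inf [set lebesgue_measure E | E in
    [set E : set R | elementary_set E /\ B `<=` E]].

Definition jordan_measurable (R : realType) (B : set R) : Prop :=
  bounded_set B /\ inner_jordan_content B = outer_jordan_content B.

(* The sequence m and the index k of the array a start at 1: m 0, a 0 n and
   a k n for n < k are junk and are never used. *)

Definition gap_ratio (R : realType) (m : nat -> nat) (k : nat) : R :=
  (m k.+1)%:R / (m k)%:R.

Definition array_norm (R : realType) (a : nat -> nat -> R) (n : nat) : R :=
  Num.sqrt (\sum_(1 <= k < n.+1) a k n ^+ 2).

Definition lacunary_sum (R : realType) (f : R -> R) (m : nat -> nat)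
    (a : nat -> nat -> R) (n : nat) (x : R) : R :=
  \sum_(1 <= k < n.+1) a k n * f ((m k)%:R * x).

(* Main.v *)
Require Import Defs.
From mathcomp Require Import ring lra.

(** Write b_k = m_(k+1) / m_k.  On a cell [j / m_(n+1), (j + 1) / m_(n+1)) the
    fractional part of m_k x, for k <= n, stays within 1 / b_k of d / b_k, where
    d is the k-th digit of j in the mixed radix system with bases b_k.  By the
    Hoelder condition the lacunary sum is uniformly within
    2 h sum_k |a_k| b_k^(-alpha), which tends to 0, of a sum of the variables
    a_k y_k(d), with y_k(d) the centred value of f at d / b_k
    ([cell_digit_sum]).  The digits of a uniform j are independent, so what is
    wanted is a local limit theorem for a sum of independent variables, with
    Lebesgue measure replaced by the proportion of cells.

    That theorem is proved without characteristic functions, by Lindeberg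
    replacement against the Gaussians g_t(y) = exp(- y^2 / 2t) / sqrt t.
    Exchanging a centred variable of variance v for a Gaussian one amounts to
    passing from g_t to g_(t+v), and the error of one exchange is at most
    C |a_k|^3 g_(2t) ([heat_kernel_lindeberg]).  It matters that this bound is
    again a heat kernel and not a constant: its mean over the remaining digits
    has, by induction, the order 1 / sqrt(t + V), where V is the variance of the
    sum.  The total error is then of order
    (sum_k |a_k|^3) / sqrt(t + V) ([heat_kernel_digit_sum]), which is still
    negligible after multiplication by A_n, because V - A_n^2 tends to 0.  So,
    with S_n the sum of the digit variables, A_n E g_s(S_n - x) tends to 1 for
    every width s, uniformly for bounded x ([local_limit_heat_kernel]).

    To reach sets, integrate over x in D.  The integral of g_s(y - x) is close to
    sqrt(2 pi) when y lies deep inside D; when y is at distance d from D it is at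
    most a small factor times the same integral at width 2s, and the mean of the
    latter is controlled by the same limit.  This bounds the proportion of cells
    from both sides ([count_limsup], [count_liminf]) with no tightness argument.
    Finally an elementary set can be shrunk or enlarged by a margin at a small
    cost in measure ([elementary_margin]), which absorbs the approximation of
    the lacunary sum by digits, and Jordan measurability encloses B between two
    elementary sets. *)

Set Implicit Arguments.
Unset Strict Implicit.
Unset Printing Implicit Defensive.

Local Open Scope classical_set_scope.
Local Open Scope ring_scope.

(** * Taylor bounds for the exponential *)

(** Mean value theorem.  Applied three times from exp itself, this gives the
    Taylor remainders below with a common shape |x|^n exp |x|. *)
Lemma pow_expR_antiderivative (R : realType) (n : nat) (F f : R -> R) :
    (forall x : R, is_derive x 1 F (f x)) -> F 0 = 0 ->
    (forall x : R, `|f x| <= `|x| ^+ n * expR `|x|) ->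
  forall x : R, `|F x| <= `|x| ^+ n.+1 * expR `|x|.
Proof.
move=> dF F0 bf x.
have key c : `|c| <= `|x| -> `|f c * x| <= `|x| ^+ n.+1 * expR `|x|.
  move=> cx; rewrite normrM exprSr -mulrA [`|x| * _]mulrC mulrA.
  rewrite ler_wpM2r//; apply: le_trans (bf c) _.
  by rewrite ler_pM ?exprn_ge0 ?expR_ge0 ?ler_expR// lerXn2r// nnegrE.
have cF : continuous F.
  by move=> y; apply/differentiable_continuous/derivable1_diffP; have [] := dF y.
have [x0|x0] := leP 0 x.
  have [c cI] := MVT_segment x0 (fun y _ => dF y) (continuous_subspaceT cF).
  rewrite F0 !subr0 => ->; apply: key.
  by move: cI; rewrite in_itv/= => /andP[c0 cx]; rewrite !ger0_norm.
have [c cI] := MVT_segment (ltW x0) (fun y _ => dF y) (continuous_subspaceT cF).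
rewrite F0 sub0r add0r mulrN => /oppr_inj ->; apply: key.
move: cI; rewrite in_itv/= => /andP[c0 cx].
by rewrite !ler0_norm ?lerN2 // ltW.
Qed.

Lemma expR_taylor1 (R : realType) (x : R) :
  `|expR x - 1| <= `|x| * expR `|x|.
Proof.
apply: (@pow_expR_antiderivative R 0 (fun x => expR x - 1) expR) => [y||y].
- by apply: is_derive_eq; rewrite subr0.
- by rewrite expR0 subrr.
- by rewrite mul1r (ger0_norm (expR_ge0 _)) ler_expR ler_norm.
Qed.

Lemma expR_taylor2 (R : realType) (x : R) :
  `|expR x - 1 - x| <= `|x| ^+ 2 * expR `|x|.
Proof.
apply: (@pow_expR_antiderivative R 1 (fun x => expR x - 1 - x)
  (fun x => expR x - 1)) => [y||y].
- by apply: is_derive_eq; rewrite subr0.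
- by rewrite expR0 subrr subr0.
- by rewrite expr1 expR_taylor1.
Qed.

Lemma expR_taylor3 (R : realType) (x : R) :
  `|expR x - 1 - x - x ^+ 2 / 2| <= `|x| ^+ 3 * expR `|x|.
Proof.
apply: (@pow_expR_antiderivative R 2 (fun x => expR x - 1 - x - x ^+ 2 / 2)
  (fun x => expR x - 1 - x)) => [y||y].
- apply: is_derive_eq; rewrite subr0 /GRing.scale/=.
  by field.
- by rewrite expR0 subrr expr0n/= mul0r !subr0.
- exact: expR_taylor2.
Qed.

(** * One Gaussian, shifted and dilated *)

Lemma expX_le_expR (R : realType) (n : nat) (x : R) :
  0 <= x -> x ^+ n <= expR (x *+ n).
Proof.
move=> x0; rewrite -mulr_natl expRM_natl lerXn2r ?nnegrE ?expR_ge0//.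
by apply: le_trans (expR_ge1Dx x); rewrite lerDr.
Qed.

(** The Gaussian on the right is wider than the one on the left: the polynomial
    factors of the Taylor remainder are paid for by weakening exp(- u^2 / 2) to
    exp(- u^2 / 4). *)
Lemma gauss_shift_expansion (R : realType) (u w : R) : `|w| <= 1 ->
  `|expR (- (u + w) ^+ 2 / 2)
     - expR (- u ^+ 2 / 2) * (1 - u * w + (u ^+ 2 - 1) * w ^+ 2 / 2)|
  <= 2 * expR 20 * `|w| ^+ 3 * expR (- u ^+ 2 / 4).
Proof.
move=> w1; pose z : R := - u * w - w ^+ 2 / 2; pose p : R := `|u| + 1.
have p1 : 1 <= p by rewrite /p lerDr.
have p0 : 0 <= p by exact: le_trans p1.
have zp : `|z| <= `|w| * p.
  rewrite /z (le_trans (ler_normB _ _))// mulNr normrN normrM normrM.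
  rewrite (ger0_norm (_ : 0 <= 2^-1)) ?invr_ge0// normrX.
  have := normr_ge0 w; have := normr_ge0 u; rewrite /p.
  by move: w1 => + u0 w0; nra.
have zp' : `|z| <= p by apply: le_trans zp _; rewrite ler_piMl.
have -> : expR (- (u + w) ^+ 2 / 2) = expR (- u ^+ 2 / 2) * expR z.
  by rewrite -expRD; congr expR; rewrite /z; field.
rewrite -mulrBr normrM (ger0_norm (expR_ge0 _)).
have bz : `|expR z - (1 - u * w + (u ^+ 2 - 1) * w ^+ 2 / 2)|
    <= 2 * `|w| ^+ 3 * expR (p *+ 4).
  have -> : expR z - (1 - u * w + (u ^+ 2 - 1) * w ^+ 2 / 2) =
      (expR z - 1 - z - z ^+ 2 / 2) + w ^+ 3 * (u / 2 + w / 8).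
    by rewrite /z; field.
  apply: le_trans (ler_normD _ _) _.
  rewrite -[leRHS]mulrA [leRHS]mulr_natl [leRHS]mulr2n; apply: lerD.
    apply: le_trans (expR_taylor3 z) _.  
    apply: (@le_trans _ _ ((`|w| * p) ^+ 3 * expR p)).
      by apply: ler_pM; rewrite ?exprn_ge0 ?expR_ge0 ?ler_expR// lerXn2r ?nnegrE// mulr_ge0.
    rewrite exprMn -mulrA ler_wpM2l ?exprn_ge0//.
    have -> : p *+ 4 = p *+ 3 + p by rewrite -mulrSr.
    by rewrite [leRHS]expRD ler_wpM2r ?expR_ge0// expX_le_expR.
  rewrite normrM normrX ler_wpM2l ?exprn_ge0//.
  apply: (@le_trans _ _ p).
    apply: le_trans (ler_normD _ _) _.
    rewrite !normrM (ger0_norm (_ : 0 <= 2^-1)) ?invr_ge0//.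
    rewrite (ger0_norm (_ : 0 <= 8^-1)) ?invr_ge0//.
    by have := normr_ge0 u; have := normr_ge0 w; rewrite /p; lra.
  apply: le_trans (expX_le_expR 4 p0).
  by rewrite -{1}(expr1 p) ler_weXn2l.
apply: le_trans (ler_wpM2l (expR_ge0 _) bz) _.
have -> : expR (- u ^+ 2 / 2) * (2 * `|w| ^+ 3 * expR (p *+ 4))
  = 2 * `|w| ^+ 3 * (expR (- u ^+ 2 / 2) * expR (p *+ 4)) by ring.
have -> : 2 * expR 20 * `|w| ^+ 3 * expR (- u ^+ 2 / 4)
  = 2 * `|w| ^+ 3 * (expR 20 * expR (- u ^+ 2 / 4)) by ring.
rewrite ler_wpM2l ?mulr_ge0 ?exprn_ge0// -!expRD ler_expR /p.
rewrite -(real_normK (num_real u)).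
(* 4 |u| + 4 - u^2 / 4 is at most 20, its value at |u| = 8. *)
by have := sqr_ge0 (`|u| - 8); rewrite -mulr_natr; lra.
Qed.

(** The linear term agrees with the quadratic term of [gauss_shift_expansion]:
    this is the heat equation, and the reason why a variance may be traded for
    an increase of the width. *)
Lemma gauss_dilation_expansion (R : realType) (u v : R) : 0 <= v <= 4^-1 ->
  `|expR (- u ^+ 2 / (2 * (1 + v))) / Num.sqrt (1 + v)
     - expR (- u ^+ 2 / 2) * (1 + (u ^+ 2 - 1) * v / 2)|
  <= 256 * expR 1 * v ^+ 2 * expR (- u ^+ 2 / 4).
Proof.
move=> /andP[v0 v1]; pose q : R := u ^+ 2 + 1.
have q1 : 1 <= q by rewrite /q lerDr sqr_ge0.
have v10 : 0 < 1 + v by lra.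
pose r : R := v / (1 + v).
have r0 : 0 <= r by rewrite divr_ge0// ltW.
have rE : r = v - v * r by rewrite /r; field; rewrite gt_eqF.
have rv : r <= v by rewrite rE; nra.
pose l : R := ln (1 + v).
have lv : l <= v by apply: le_ln1Dx; lra.
have lr : r <= l.
  have : ln (1 + v)^-1 <= (1 + v)^-1 - 1.
    have := @le_ln1Dx R ((1 + v)^-1 - 1); rewrite addrCA subrr addr0; apply.
    by have : 0 < (1 + v)^-1 by [rewrite invr_gt0]; lra.
  rewrite lnV ?posrE// -/l.
  have -> : (1 + v)^-1 - 1 = - r by rewrite /r; field; rewrite gt_eqF.
  by rewrite lerN2.
have sqrtE : (Num.sqrt (1 + v))^-1 = expR (- (l / 2)).
  rewrite expRN; congr (_^-1); rewrite -[1 + v]lnK ?posrE// -/l.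
  have -> : l = l / 2 + l / 2 by field.
  rewrite expRD -expr2 sqrtr_sqr ger0_norm ?expR_ge0//.
  by congr expR; field.
(* The dilated Gaussian is exp(- u^2 / 2) exp z, where z is (u^2 - 1) v / 2 up to
   a multiple of (u^2 + 1) v^2. *)
pose z : R := u ^+ 2 * r / 2 - l / 2.
have -> : expR (- u ^+ 2 / (2 * (1 + v))) / Num.sqrt (1 + v)
    = expR (- u ^+ 2 / 2) * expR z.
  rewrite sqrtE -!expRD; congr expR; rewrite /z /r; field.
  by rewrite gt_eqF.
rewrite -mulrBr normrM (ger0_norm (expR_ge0 _)).
have u20 : 0 <= u ^+ 2 by exact: sqr_ge0.
have zq : `|z| <= q * v / 2.
  by rewrite ler_norml /z /q; apply/andP; split; nra.
have zd : `|z - (u ^+ 2 - 1) * v / 2| <= q * v ^+ 2 / 2.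
  have vr : v - r <= v ^+ 2 by rewrite {1}rE; nra.
  by rewrite ler_norml /z /q; apply/andP; split; nra.
have bz : `|expR z - (1 + (u ^+ 2 - 1) * v / 2)| <= v ^+ 2 * (256 * expR (q / 4)).
  have -> : expR z - (1 + (u ^+ 2 - 1) * v / 2)
    = (expR z - 1 - z) + (z - (u ^+ 2 - 1) * v / 2) by ring.
  apply: le_trans (ler_normD _ _) _.
  apply: (@le_trans _ _ (v ^+ 2 * (q ^+ 2 * expR (q / 8)))).
    have e1 : 1 <= expR (q / 8) by apply: le_trans (expR_ge1Dx _); lra.
    apply: (@le_trans _ _ (q ^+ 2 * v ^+ 2 / 4 * expR (q / 8) + q * v ^+ 2 / 2)).
      apply: lerD => //; apply: le_trans (expR_taylor2 z) _.
      apply: ler_pM; rewrite ?exprn_ge0 ?expR_ge0 ?ler_expR//.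
        have -> : q ^+ 2 * v ^+ 2 / 4 = (q * v / 2) ^+ 2 by field.
        by rewrite lerXn2r ?nnegrE//; nra.
      by apply: le_trans zq _; nra.
    have : q * v ^+ 2 <= q ^+ 2 * v ^+ 2 * expR (q / 8).
      rewrite -[leLHS]mulr1; apply: ler_pM => //; nra.
    have : 0 <= q ^+ 2 * v ^+ 2 * expR (q / 8) by rewrite mulr_ge0 ?expR_ge0// -exprMn sqr_ge0.
    by lra.
  rewrite ler_wpM2l ?sqr_ge0//.
  have -> : expR (q / 4) = expR ((q / 16) *+ 2) * expR (q / 8).
    by rewrite -expRD; congr expR; field.
  rewrite mulrA ler_wpM2r ?expR_ge0//.
  have -> : q ^+ 2 = 256 * (q / 16) ^+ 2 by field.
  by rewrite ler_pM2l// expX_le_expR//; lra.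
apply: le_trans (ler_wpM2l (expR_ge0 _) bz) _.
have -> : expR (- u ^+ 2 / 2) * (v ^+ 2 * (256 * expR (q / 4)))
  = 256 * v ^+ 2 * (expR (- u ^+ 2 / 2) * expR (q / 4)) by ring.
have -> : 256 * expR 1 * v ^+ 2 * expR (- u ^+ 2 / 4)
  = 256 * v ^+ 2 * (expR 1 * expR (- u ^+ 2 / 4)) by ring.
rewrite ler_wpM2l ?mulr_ge0 ?sqr_ge0// -!expRD ler_expR /q; lra.
Qed.

(** * Averages and the Lindeberg step *)

Definition mean (R : realType) (b : nat) (F : nat -> R) : R :=
  (\sum_(0 <= d < b) F d) / b%:R.

Section Mean.
Variables (R : realType) (b : nat).
Implicit Types F G : nat -> R.

Lemma eq_mean F G : (forall d, (d < b)%N -> F d = G d) -> mean b F = mean b G.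
Proof. by move=> e; rewrite /mean; congr (_ / _); apply: eq_big_nat => d /= /e. Qed.

Lemma meanD F G : mean b (fun d => F d + G d) = mean b F + mean b G.
Proof. by rewrite /mean big_split/= mulrDl. Qed.

Lemma meanZ (k : R) F : mean b (fun d => k * F d) = k * mean b F.
Proof. by rewrite /mean -mulr_sumr mulrA. Qed.

Lemma meanB F G : mean b (fun d => F d - G d) = mean b F - mean b G.
Proof.
under eq_mean => d _ do rewrite -mulN1r.
by rewrite meanD meanZ mulN1r.
Qed.

Lemma le_mean F G : (forall d, (d < b)%N -> F d <= G d) -> mean b F <= mean b G.
Proof.
move=> e; rewrite /mean ler_wpM2r ?invr_ge0// !big_nat.
by apply: ler_sum => d /= /e.
Qed.

Lemma mean_ge0 F : (forall d, (d < b)%N -> 0 <= F d) -> 0 <= mean b F.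
Proof.
by move=> e; rewrite /mean divr_ge0// big_nat; apply: sumr_ge0 => d /= /e.
Qed.

Lemma ler_norm_mean F : `|mean b F| <= mean b (fun d => `|F d|).
Proof.
rewrite /mean normrM (ger0_norm (_ : 0 <= b%:R^-1)) ?invr_ge0//.
by rewrite ler_wpM2r ?invr_ge0// ler_norm_sum.
Qed.

Hypothesis b0 : (0 < b)%N.

Lemma mean_cst (k : R) : mean b (fun=> k) = k.
Proof.
rewrite /mean big_const_nat subn0 iter_addr_0 -(mulr_natr k) mulfK//.
by rewrite pnatr_eq0 -lt0n.
Qed.

Lemma mean_norm_le F c : (forall d, (d < b)%N -> `|F d| <= c) -> `|mean b F| <= c.
Proof.
move=> Fc; apply: le_trans (ler_norm_mean _) _.
by rewrite -[leRHS]mean_cst; apply: le_mean.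
Qed.

End Mean.

(** The quotient and the remainder by b of a uniform j < M b are independent and
    uniform. *)
Lemma mean_divmod (R : realType) (M b : nat) (F : nat -> nat -> R) : (0 < b)%N ->
  mean (M * b) (fun j => F (j %/ b)%N (j %% b)%N) =
  mean M (fun i => mean b (F i)).
Proof.
move=> b0; rewrite /mean big_nat_mul natrM invfM mulrCA mulrC; congr (_ * _).
rewrite mulr_suml; apply: eq_big_nat => i _; congr (_ * _).
rewrite -{1}[(i * b)%N]add0n big_addn mulSn addnK.
apply: eq_big_nat => d /andP[_ db].
by rewrite addnC divnMDl// modnMDl divn_small// modn_small// addn0.
Qed.

(** Centred Gaussian density of variance t, up to the factor sqrt (2 pi). *)
Definition heat_kernel (R : realType) (t x : R) : R :=
  expR (- x ^+ 2 / (2 * t)) / Num.sqrt t.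

Lemma heat_kernel_ge0 (R : realType) (t x : R) : 0 <= heat_kernel t x.
Proof. by rewrite divr_ge0 ?expR_ge0 ?sqrtr_ge0. Qed.

Lemma heat_kernel_le (R : realType) (t x : R) :
  0 < t -> heat_kernel t x <= (Num.sqrt t)^-1.
Proof.
move=> t0; rewrite /heat_kernel ler_piMl ?invr_ge0 ?sqrtr_ge0//.
rewrite -[leRHS]expR0 ler_expR mulNr oppr_le0 divr_ge0 ?sqr_ge0//.
by rewrite mulr_ge0// ltW.
Qed.

(** After rescaling by sqrt t, both terms have the same expansion to second
    order, since u has mean 0 and the variance added to t is that of u.  The
    square of that variance is absorbed by c^3 because c / sqrt t <= 1/2. *)
Lemma heat_kernel_lindeberg (R : realType) : exists2 C : R, 0 < C &
  forall (s : R) (b : nat) (u : nat -> R) (c t x : R),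
    0 < s -> s <= t -> (0 < b)%N ->
    (forall d, (d < b)%N -> `|u d| <= c) -> c <= Num.sqrt s / 2 ->
    mean b u = 0 ->
  `|mean b (fun d => heat_kernel t (x + u d))
     - heat_kernel (t + mean b (fun d => u d ^+ 2)) x|
  <= C / Num.sqrt s ^+ 3 * c ^+ 3 * heat_kernel (2 * t) x.
Proof.
(* The constants of the two expansions; sqrt 2 normalises the kernel of width 2t. *)
pose C : R := 2 * expR 20 + 256 * expR 1.
exists (C * Num.sqrt 2).
  by rewrite mulr_gt0 ?sqrtr_gt0// addr_gt0// mulr_gt0 ?expR_gt0.
move=> s b u c t x s0 st b0 uc cs mu0.
set v := mean b (fun d => u d ^+ 2).
have t0 : 0 < t by exact: lt_le_trans st.
pose r : R := Num.sqrt t; have r0 : 0 < r by rewrite sqrtr_gt0.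
have r2 : r ^+ 2 = t by rewrite sqr_sqrtr// ltW.
have rn0 : r != 0 by rewrite gt_eqF.
have sr : Num.sqrt s <= r by rewrite ler_wsqrtr.
have sq0 : 0 < Num.sqrt s by rewrite sqrtr_gt0.
pose e := x / r; pose W d := u d / r; pose k := c / r.
have c0 : 0 <= c by apply: le_trans (normr_ge0 _) (uc 0%N b0).
have k0 : 0 <= k by rewrite divr_ge0// ltW.
have k2 : k <= 2^-1 by rewrite ler_pdivrMr//; lra.
have Wk d : (d < b)%N -> `|W d| <= k.
  move=> /uc uk; rewrite /W normrM (ger0_norm (_ : 0 <= r^-1)) ?invr_ge0 ?(ltW r0)//.
  by rewrite ler_wpM2r// invr_ge0 ltW.
pose w := v / t.
have wE : w = mean b (fun d => W d ^+ 2).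
  rewrite /w mulrC -meanZ; apply: eq_mean => d _.
  by rewrite /W -r2; field.
have w0 : 0 <= w by rewrite wE; apply: mean_ge0 => d _; exact: sqr_ge0.
have wk : w <= k ^+ 2.
  rewrite wE -[leRHS](mean_cst b0); apply: le_mean => d db.
  by rewrite -(real_normK (num_real _)) lerXn2r ?nnegrE// Wk.
have mW : mean b W = 0.
  rewrite -(mulr0 r^-1) -mu0 -meanZ; apply: eq_mean => d _.
  by rewrite /W mulrC.
have E1 : mean b (fun d => heat_kernel t (x + u d)) =
    r^-1 * mean b (fun d => expR (- (e + W d) ^+ 2 / 2)).
  rewrite -meanZ; apply: eq_mean => d _.
  rewrite /heat_kernel -/r mulrC; congr (_ * expR _).
  by rewrite /e /W -r2; field.
have E2 : heat_kernel (t + v) x =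
    r^-1 * (expR (- e ^+ 2 / (2 * (1 + w))) / Num.sqrt (1 + w)).
  have -> : t + v = t * (1 + w) by rewrite /w; field; rewrite gt_eqF.
  rewrite /heat_kernel sqrtrM ?(ltW t0)// -/r.
  have -> : - x ^+ 2 / (2 * (t * (1 + w))) = - e ^+ 2 / (2 * (1 + w)).
    by rewrite /e -r2; field; rewrite rn0 andbT; apply: lt0r_neq0; lra.
  by rewrite [(r * _)^-1]invfM [LHS]mulrCA.
have E3 : heat_kernel (2 * t) x = r^-1 * (expR (- e ^+ 2 / 4) / Num.sqrt 2).
  rewrite /heat_kernel sqrtrM// -/r.
  have -> : - x ^+ 2 / (2 * (2 * t)) = - e ^+ 2 / 4.
    by rewrite /e -r2; field.
  by rewrite [(Num.sqrt 2 * r)^-1]invfM [RHS]mulrCA [r^-1 * _]mulrC.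
rewrite E1 E2 E3 -mulrBr normrM (ger0_norm (_ : 0 <= r^-1)) ?invr_ge0 ?(ltW r0)//.
have -> : C * Num.sqrt 2 / Num.sqrt s ^+ 3 * c ^+ 3 *
     (r^-1 * (expR (- e ^+ 2 / 4) / Num.sqrt 2)) =
     r^-1 * (C * (c / Num.sqrt s) ^+ 3 * expR (- e ^+ 2 / 4)).
  have : Num.sqrt (2 : R) != 0 by rewrite gt_eqF// sqrtr_gt0.
  by move=> sqrt2; field; rewrite rn0 sqrt2 gt_eqF.
rewrite ler_wpM2l ?invr_ge0 ?(ltW r0)//.
apply: (@le_trans _ _ (C * k ^+ 3 * expR (- e ^+ 2 / 4))); last first.
  rewrite ler_wpM2r ?expR_ge0// ler_wpM2l//.
    by rewrite addr_ge0 ?mulr_ge0 ?expR_ge0.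
  rewrite lerXn2r ?nnegrE ?divr_ge0 ?sqrtr_ge0//.
  by rewrite ler_wpM2l// lef_pV2 ?posrE.
pose T d := expR (- e ^+ 2 / 2) * (1 - e * W d + (e ^+ 2 - 1) * W d ^+ 2 / 2).
have mT : mean b T = expR (- e ^+ 2 / 2) * (1 + (e ^+ 2 - 1) * w / 2).
  rewrite meanZ; congr (_ * _); rewrite meanD meanB mean_cst// meanZ mW mulr0 subr0.
  congr (_ + _); rewrite -mulrA mulrC -mulrA [RHS]mulrC -mulrA wE -meanZ.
  by rewrite -meanZ; apply: eq_mean => d _; ring.
rewrite -(subrKA (mean b T)) -meanB.
apply: le_trans (ler_normD _ _) _.
have -> : C * k ^+ 3 * expR (- e ^+ 2 / 4) =
  2 * expR 20 * k ^+ 3 * expR (- e ^+ 2 / 4) +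
  256 * expR 1 * k ^+ 3 * expR (- e ^+ 2 / 4) by rewrite /C; ring.
apply: lerD.
  apply: mean_norm_le => // d db; apply: le_trans (gauss_shift_expansion _ _) _.
    by apply: le_trans (Wk _ db) _; lra.
  rewrite ler_wpM2r ?expR_ge0// ler_wpM2l ?mulr_ge0 ?expR_ge0//.
  by rewrite lerXn2r ?nnegrE// Wk.
rewrite mT distrC; apply: le_trans (gauss_dilation_expansion _ _) _.
  by rewrite w0; apply: le_trans wk _; nra.
rewrite ler_wpM2r ?expR_ge0// ler_wpM2l ?mulr_ge0 ?expR_ge0//.
apply: (@le_trans _ _ ((k ^+ 2) ^+ 2)); first by rewrite lerXn2r ?nnegrE ?sqr_ge0.
by rewrite -exprM (exprS _ 3) ler_piMl ?exprn_ge0//; lra.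
Qed.

(** * Iterating the step along the digits *)

(** The last of the k digits is the remainder, so that peeling it off leaves the
    index of the enclosing cell one level up. *)
Fixpoint digit_sum (R : realType) (b : nat -> nat) (u : nat -> nat -> R)
    (k j : nat) : R :=
  if k is k'.+1 then digit_sum b u k' (j %/ b k) + u k (j %% b k)%N else 0.

Definition digit_var (R : realType) (b : nat -> nat) (u : nat -> nat -> R)
    (n : nat) : R :=
  \sum_(1 <= k < n.+1) mean (b k) (fun d => u k d ^+ 2).

(** Induction on n, for all widths t >= s at once.  Exchanging the last digit
    for a Gaussian of variance v costs D c^3 times the mean of the kernel of
    width 2t over the first n - 1 digits.  The induction hypothesis at width 2t
    bounds that mean by 2 / sqrt (2t + V), and 2t + V >= t + v + V because
    v <= s <= t; at width t + v it handles the other term. *)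
Lemma heat_kernel_digit_sum (R : realType) : exists2 C : R, 0 < C &
  forall (s : R) (M b : nat -> nat) (u : nat -> nat -> R) (c : nat -> R) (n : nat),
    let L k := \sum_(1 <= i < k.+1) c i ^+ 3 in
    let D := C / Num.sqrt s ^+ 3 in
    0 < s -> (0 < M 0)%N ->
    (forall k, (k < n)%N -> M k.+1 = (M k * b k.+1)%N) ->
    (forall k, (1 <= k <= n)%N -> [/\ (0 < b k)%N, mean (b k) (u k) = 0,
       c k <= Num.sqrt s / 2 & forall d, (d < b k)%N -> `|u k d| <= c k]) ->
    D * L n <= 1 / 2 ->
  forall t x : R, s <= t ->
    `|mean (M n) (fun j => heat_kernel t (digit_sum b u n j - x))
      - heat_kernel (t + digit_var b u n) x|
    <= 2 * D * L n / Num.sqrt (t + digit_var b u n).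
Proof.
have [C C0 onestep] := heat_kernel_lindeberg R; exists C => //.
move=> s M b u c n L D s0 M0 Mrec hyp.
have D0 : 0 <= D by rewrite divr_ge0 ?(ltW C0)// exprn_ge0// sqrtr_ge0.
have Mgt0 : forall k, (k <= n)%N -> (0 < M k)%N.
  elim=> [//|k IH] kn; rewrite Mrec// muln_gt0 (IH (ltnW kn))/=.
  by have [] := hyp k.+1 kn.
elim: n Mrec hyp Mgt0 => [|n IH] Mrec hyp Mgt0 DL t x st.
  rewrite /L /digit_var !big_geq// mulr0 mul0r addr0.
  rewrite (eq_mean (G := fun=> heat_kernel t x)) ?(mean_cst M0) ?subrr ?normr0//.
  by move=> j _; rewrite /= /heat_kernel sub0r sqrrN.
have [b0 mu0 cs uc] := hyp n.+1 (leqnn _).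
set V := digit_var b u n in IH *.
pose v := mean (b n.+1) (fun d => u n.+1 d ^+ 2).
have VE : digit_var b u n.+1 = v + V by rewrite /digit_var big_nat_recr//= addrC.
have LE : L n.+1 = L n + c n.+1 ^+ 3 by rewrite /L big_nat_recr.
have c0 : 0 <= c n.+1 by apply: le_trans (normr_ge0 _) (uc 0%N b0).
have {}IH t' x' : s <= t' ->
    `|mean (M n) (fun j => heat_kernel t' (digit_sum b u n j - x'))
      - heat_kernel (t' + V) x'| <= 2 * D * L n / Num.sqrt (t' + V).
  apply: IH => [k kn|k /andP[k1 kn]|k kn|].
  - exact/Mrec/ltnW.
  - by apply: hyp; rewrite k1 ltnW.
  - exact/Mgt0/ltnW.
  - by apply: le_trans DL; rewrite LE ler_wpM2l// lerDl exprn_ge0.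
have v0 : 0 <= v by apply: mean_ge0 => d _; exact: sqr_ge0.
have V0 : 0 <= V.
  by rewrite /V /digit_var; apply: sumr_ge0 => k _; apply: mean_ge0 => d _; exact: sqr_ge0.
have t0 : 0 < t by exact: lt_le_trans st.
have vt : v <= t.
  apply: le_trans st; apply: (@le_trans _ _ (c n.+1 ^+ 2)).
    rewrite -[leRHS](mean_cst b0); apply: le_mean => d db.
    by rewrite -(real_normK (num_real _)) lerXn2r ?nnegrE// uc.
  have := sqr_sqrtr (ltW s0); have := sqrtr_ge0 s.
  by move: cs c0; set r := Num.sqrt s; nra.
have tv : s <= t + v by rewrite -[s]addr0 lerD.
rewrite VE addrA Mrec// LE.
rewrite (@mean_divmod R (M n) (b n.+1)
  (fun i d => heat_kernel t (digit_sum b u n i + u n.+1 d - x)))//.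
rewrite -(subrKA (mean (M n) (fun j => heat_kernel (t + v) (digit_sum b u n j - x)))).
apply: le_trans (ler_normD _ _) _.
set q := (Num.sqrt (t + v + V))^-1.
have q0 : 0 <= q by rewrite invr_ge0 sqrtr_ge0.
have step1 : mean (M n) (fun j => heat_kernel (2 * t) (digit_sum b u n j - x)) <= 2 * q.
  have t2 : s <= 2 * t by lra.
  have := IH (2 * t) x t2; rewrite ler_norml => /andP[_ ].
  rewrite lerBlDr => /le_trans; apply.
  have q2 : (Num.sqrt (2 * t + V))^-1 <= q.
    rewrite lef_pV2 ?posrE ?sqrtr_gt0; [|lra|lra].
    by rewrite ler_wsqrtr//; lra.
  have := @heat_kernel_le R (2 * t + V) x.
  have /[swap]/[apply] : 0 < 2 * t + V by lra.
  have q20 : 0 <= (Num.sqrt (2 * t + V))^-1 by rewrite invr_ge0 sqrtr_ge0.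
  have : D * L n <= 1 / 2.
    by apply: le_trans DL; rewrite LE ler_wpM2l// lerDl exprn_ge0.
  move: q2 q20; set p := (_)^-1 => q2 p0 DLn hp.
  by nra.
have step2 : `|mean (M n) (fun i => mean (b n.+1) (fun d =>
      heat_kernel t (digit_sum b u n i + u n.+1 d - x)))
    - mean (M n) (fun j => heat_kernel (t + v) (digit_sum b u n j - x))|
    <= D * c n.+1 ^+ 3 * (2 * q).
  rewrite -meanB; apply: le_trans (ler_norm_mean _ _) _.
  apply: (@le_trans _ _ (D * c n.+1 ^+ 3 * mean (M n) (fun j =>
      heat_kernel (2 * t) (digit_sum b u n j - x)))).
    rewrite -meanZ; apply: le_mean => j _.
    apply: le_trans (onestep s (b n.+1) (u n.+1) (c n.+1) t _ s0 st b0 uc cs mu0).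
    by under eq_mean => d _ do rewrite addrAC.
  by rewrite ler_wpM2l// mulr_ge0// exprn_ge0.
have step3 := IH (t + v) x tv.
apply: le_trans (lerD step2 step3) _.
by rewrite -/q le_eqVlt; apply/orP; left; apply/eqP; ring.
Qed.

(** * Local limit for Gaussian test functions *)

(** The kernel of variance s + V is flat at the scale of x, and its height
    1 / sqrt (s + V) is 1 / A up to a relative error O(1 / A^2). *)
Lemma heat_kernel_flat (R : realType) (s r A V k m x : R) :
    0 < s -> 2 <= A -> `|V - A ^+ 2| <= 1 -> `|x| <= r ->
    `|m - heat_kernel (s + V) x| <= k / Num.sqrt (s + V) ->
  `|A * m - 1| <= 2 * k + (2 * (s + 1) + 4 * r ^+ 2) / A.
Proof.
move=> s0 A2 VA xr hm.
have A0 : 0 < A by lra.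
have [VA1 VA2] : V <= A ^+ 2 + 1 /\ A ^+ 2 - 1 <= V.
  by move: VA; rewrite ler_norml => /andP[? ?]; split; lra.
have t0 : 0 < s + V by nra.
set N := Num.sqrt (s + V) in hm *.
have N0 : 0 < N by rewrite sqrtr_gt0.
have N2 : N ^+ 2 = s + V by rewrite sqr_sqrtr// ltW.
pose q := A / N.
have qN : q * N = A by rewrite /q divfK// gt_eqF.
have q0 : 0 < q by rewrite divr_gt0.
have NA : A <= 2 * N by nra.
have q2 : q <= 2 by rewrite ler_pdivrMr.
have A1 : A^-1 <= 1 by rewrite invf_le1//; lra.
have iA0 : 0 < A^-1 by rewrite invr_gt0.
have AA : A * A^-1 = 1 by rewrite mulfV// gt_eqF.
have h1 : `|q - 1| <= 2 * (s + 1) / A.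
  have -> : q - 1 = (A ^+ 2 - N ^+ 2) / (N * (A + N)).
    by rewrite /q; field; rewrite !gt_eqF// addr_gt0.
  rewrite normrM (ger0_norm (_ : 0 <= (N * (A + N))^-1)); last first.
    by rewrite invr_ge0 mulr_ge0 ?addr_ge0 ?ltW.
  have : `|A ^+ 2 - N ^+ 2| <= s + 1.
    by rewrite N2 ler_norml; apply/andP; split; lra.
  move=> h; rewrite ler_pdivrMr ?mulr_gt0 ?addr_gt0//; apply: le_trans h _.
  have -> : 2 * (s + 1) / A * (N * (A + N)) = (s + 1) * ((2 * N / A) * (A + N)).
    by ring.
  rewrite ler_peMr//; first lra.
  by rewrite mulr_ege1//; [rewrite ler_pdivlMr// mul1r|lra].
pose e := expR (- x ^+ 2 / (2 * (s + V))).
have e1 : e <= 1.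
  rewrite -[leRHS]expR0 ler_expR mulNr oppr_le0 divr_ge0 ?sqr_ge0//.
  by rewrite mulr_ge0// ltW.
have h2 : 1 - e <= 2 * r ^+ 2 / A.
  have := expR_ge1Dx (- x ^+ 2 / (2 * (s + V))); rewrite -/e => he.
  apply: (@le_trans _ _ (x ^+ 2 / (2 * (s + V)))); first lra.
  rewrite -N2 -mulrA mulrA invfM mulrA ler_pdivrMr ?exprn_gt0//.
  have xr2 : x ^+ 2 <= r ^+ 2.
    by rewrite -(real_normK (num_real x)) lerXn2r// nnegrE// (le_trans _ xr).
  have : 1 <= 4 * A^-1 * N ^+ 2.
    by rewrite mulrAC ler_pdivlMr// mul1r; nra.
  have := sqr_ge0 x; set z := A^-1 in iA0 A1 AA *; set y := N ^+ 2 => x20 h.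
  have := sqr_ge0 r; by nra.
have hk : A * heat_kernel (s + V) x = q * e.
  by rewrite /heat_kernel -/N -/e /q; ring.
have -> : A * m - 1 = A * (m - heat_kernel (s + V) x) + ((q - 1) - q * (1 - e)).
  by rewrite mulrBr hk; ring.
apply: le_trans (ler_normD _ _) _; apply: lerD.
  rewrite normrM (gtr0_norm A0).
  apply: le_trans (ler_wpM2l (ltW A0) hm) _.
  have k0 : 0 <= k.
    by have := le_trans (normr_ge0 _) hm; rewrite pmulr_lge0 ?invr_gt0.
  by rewrite mulrCA mulrC ler_wpM2r.
apply: le_trans (ler_normB _ _) _.
rewrite [leRHS]mulrDl; apply: lerD => //.
rewrite normrM (gtr0_norm q0) ger0_norm ?subr_ge0//.
have : 4 * r ^+ 2 / A = 2 * (2 * r ^+ 2 / A) by ring.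
move: h2; set w := 2 * r ^+ 2 / A => h2 ->; nra.
Qed.

Lemma nat_sum_term_le (R : realType) (n k : nat) (F : nat -> R) :
  (forall i, 0 <= F i) -> (1 <= k <= n)%N -> F k <= \sum_(1 <= i < n.+1) F i.
Proof.
move=> F0 /andP[k1 kn]; rewrite (bigD1_seq k) ?iota_uniq//=; last first.
  by rewrite mem_index_iota k1 ltnS.
by rewrite lerDl; apply: sumr_ge0 => i _.
Qed.

Lemma local_limit_heat_kernel (R : realType) (M b : nat -> nat)
    (y : nat -> nat -> R) (a : nat -> nat -> R) (K : R) :
    let u n k d := a k n * y k d in
    (0 < M 0)%N -> (forall k, M k.+1 = (M k * b k.+1)%N) ->
    (forall k, (1 <= k)%N -> [/\ (0 < b k)%N, mean (b k) (y k) = 0 &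
       forall d, (d < b k)%N -> `|y k d| <= K]) ->
    array_norm a n @[n --> \oo] --> +oo ->
    \sum_(1 <= k < n.+1) `|a k n| ^+ 3 @[n --> \oo] --> (0 : R) ->
    digit_var b (u n) n - array_norm a n ^+ 2 @[n --> \oo] --> (0 : R) ->
  forall s r e : R, 0 < s -> 0 < e ->
  \forall n \near \oo, forall x, `|x| <= r ->
    `|array_norm a n * mean (M n) (fun j => heat_kernel s (digit_sum b (u n) n j - x))
       - 1| <= e.
Proof.
move=> u M0 Mrec hy Aoo a3 VA s r e s0 e0.
have [C C0 lind] := heat_kernel_digit_sum R.
pose D := C / Num.sqrt s ^+ 3.
have sq0 : 0 < Num.sqrt s by rewrite sqrtr_gt0.
have D0 : 0 < D by rewrite divr_gt0// exprn_gt0.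
have K0 : 0 <= K.
  by have [b1 _ yK] := hy 1%N isT; apply: le_trans (normr_ge0 _) (yK 0%N b1).
(* Any positive bound on the digits will do; K itself may vanish. *)
pose G := K + 1.
have G0 : 0 < G by rewrite ltr_wpDl.
pose T := (2 * (s + 1) + 4 * r ^+ 2) / (e / 2) + 2.
have r20 := sqr_ge0 r.
have T2 : 2 <= T.
  by rewrite /T lerDr divr_ge0 ?(ltW e0)//; [lra|rewrite divr_ge0 ?(ltW e0)].
pose l1 := (Num.sqrt s / 2 / G) ^+ 3.
pose l2 := 1 / 2 / (D * G ^+ 3).
pose l3 := e / 8 / (D * G ^+ 3).
have G3 : 0 < G ^+ 3 by rewrite exprn_gt0.
have DG : 0 < D * G ^+ 3 by rewrite mulr_gt0.
have l10 : 0 < l1 by rewrite exprn_gt0// !divr_gt0.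
have l20 : 0 < l2 by rewrite !divr_gt0.
have l30 : 0 < l3 by rewrite !divr_gt0.
have Ll l : 0 < l -> (\forall n \near \oo, \sum_(1 <= k < n.+1) `|a k n| ^+ 3 <= l).
  move=> l0; move/cvgrPdist_le : a3 => /(_ l l0); apply: filterS => k.
  by rewrite sub0r normrN; apply: le_trans; exact: ler_norm.
near=> n.
have TA : T <= array_norm a n by near: n; move/cvgryPge : Aoo; exact.
have Ll1 : \sum_(1 <= k < n.+1) `|a k n| ^+ 3 <= l1 by near: n; exact: Ll.
have Ll2 : \sum_(1 <= k < n.+1) `|a k n| ^+ 3 <= l2 by near: n; exact: Ll.
have Ll3 : \sum_(1 <= k < n.+1) `|a k n| ^+ 3 <= l3 by near: n; exact: Ll.
have VA1 : `|digit_var b (u n) n - array_norm a n ^+ 2| <= 1.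
  near: n; move/cvgrPdist_le : VA => /(_ 1 ltr01); apply: filterS => k.
  by rewrite sub0r normrN.
move=> x xr; set A := array_norm a n in TA VA1 *.
set L := \sum_(1 <= k < n.+1) `|a k n| ^+ 3 in Ll1 Ll2 Ll3.
have LE : \sum_(1 <= k < n.+1) (`|a k n| * G) ^+ 3 = L * G ^+ 3.
  by rewrite mulr_suml; apply: eq_bigr => k _; rewrite exprMn.
have ak k : (1 <= k <= n)%N -> `|a k n| ^+ 3 <= L.
  by apply: (@nat_sum_term_le R n k (fun k => `|a k n| ^+ 3)) => i; exact: exprn_ge0.
have := lind s M b (u n) (fun k => `|a k n| * G) n.
rewrite /= -/D LE => /(_ s0 M0 (fun k _ => Mrec k)).
have h1 k : (1 <= k <= n)%N -> [/\ (0 < b k)%N, mean (b k) (u n k) = 0,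
       `|a k n| * G <= Num.sqrt s / 2 &
       forall d, (d < b k)%N -> `|u n k d| <= `|a k n| * G].
  move=> kn; have /andP[k1 _] := kn; have [b0 m0 yK] := hy k k1; split => //.
  - by rewrite meanZ m0 mulr0.
  - rewrite -ler_pdivlMr//.
    rewrite -(@ler_pXn2r _ 3)// ?nnegrE ?divr_ge0 ?(ltW sq0) ?(ltW G0)//.
    exact: le_trans (ak k kn) Ll1.
  - move=> d db; rewrite /u normrM ler_wpM2l//.
    by apply: le_trans (yK d db) _; rewrite /G lerDl.
have h2 : D * (L * G ^+ 3) <= 1 / 2.
  by rewrite mulrCA -ler_pdivlMr.
move=> /(_ h1 h2 s x (lexx s)) h3.
have A2 : 2 <= A by exact: le_trans TA.
apply: le_trans (heat_kernel_flat s0 A2 VA1 xr h3) _.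
have : D * (L * G ^+ 3) <= e / 8 by rewrite mulrCA -ler_pdivlMr.
have A0 : 0 < A by lra.
have : (2 * (s + 1) + 4 * r ^+ 2) / A <= e / 2.
  rewrite ler_pdivrMr// [_ * A]mulrC -ler_pdivrMr ?divr_gt0//.
  by apply: le_trans TA; rewrite /T lerDl.
by lra.
Unshelve. all: by end_near.
Qed.

(** * Gaussian mass of a set *)

Lemma Rintegral_near_cst (R : realType) (D : set (measurableTypeR R))
    (F : R -> R) (k e : R) : measurable D -> (lebesgue_measure D < +oo)%E ->
    lebesgue_measure.-integrable D (EFin \o F) ->
    (forall x, D x -> `|F x - k| <= e) ->
  `|\int[lebesgue_measure]_(x in D) F x - k * fine (lebesgue_measure D)|
  <= e * fine (lebesgue_measure D).
Proof.
move=> mD Dfin IF close.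
have I1 c : (@lebesgue_measure R).-integrable D (EFin \o (fun=> c)).
  apply: measurable_bounded_integrable => //.
  by exists (`|c|); split; [exact: num_real|move=> z cz x _ /=; exact: ltW].
have IB := integrableB mD IF (I1 k).
rewrite -Rintegral_cst// -RintegralB//.
apply: le_trans (le_normr_Rintegral mD IB) _.
rewrite -Rintegral_cst//; apply: le_Rintegral => //.
exact: (integrable_norm IB).
Qed.

Definition gauss_mass (R : realType) (s y : R) (D : set (measurableTypeR R)) : R :=
  \int[lebesgue_measure]_(x in D) heat_kernel s (y - x).

Section GaussMass.
Variable R : realType.
Local Notation mu := (@lebesgue_measure R).
Implicit Types (s x y d : R) (D : set (measurableTypeR R)).

Lemma heat_kernel_normal_pdf s y x : 0 < s ->
  heat_kernel s (y - x) = Num.sqrt (2 * pi) * normal_pdf y (Num.sqrt s) x.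
Proof.
move=> s0; have sq0 : 0 < Num.sqrt s by rewrite sqrtr_gt0.
rewrite normal_pdfE ?gt_eqF//= /normal_peak /normal_fun sqr_sqrtr ?(ltW s0)//.
have -> : s * pi *+ 2 = (2 * pi) * s by rewrite -mulr_natr; ring.
rewrite [Num.sqrt (2 * pi * s)]sqrtrM ?mulr_ge0 ?pi_ge0// /heat_kernel.
have -> : - (y - x) ^+ 2 / (2 * s) = - (x - y) ^+ 2 / (s *+ 2).
  by rewrite -(mulr_natr s) (mulrC s) -[y - x]opprB sqrrN.
have p0 : Num.sqrt (2 * pi : R) != 0 by rewrite gt_eqF// sqrtr_gt0 mulr_gt0 ?pi_gt0.
by field; rewrite p0 gt_eqF.
Qed.

Lemma integrable_heat_kernel s y D : 0 < s -> measurable D ->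
  mu.-integrable D (fun x => (heat_kernel s (y - x))%:E).
Proof.
move=> s0 mD; apply: (@integrableS _ _ _ mu setT) => //.
have := integrableZl measurableT (Num.sqrt (2 * pi)) (integrable_normal_pdf y (Num.sqrt s)).
apply: eq_integrable => // x _ /=.
by rewrite heat_kernel_normal_pdf.
Qed.

Lemma gauss_mass_setT s y : 0 < s -> gauss_mass s y setT = Num.sqrt (2 * pi).
Proof.
move=> s0; rewrite /gauss_mass.
under eq_Rintegral => x _ do rewrite heat_kernel_normal_pdf//.
rewrite RintegralZl//; last exact: integrable_normal_pdf.
by rewrite /Rintegral integral_normal_pdf /= mulr1.
Qed.

Lemma gauss_mass_ge0 s y D : 0 <= gauss_mass s y D.
Proof. by apply: Rintegral_ge0 => x _; exact: heat_kernel_ge0. Qed.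

Lemma gauss_massC s y D : 0 < s -> measurable D ->
  gauss_mass s y D + gauss_mass s y (~` D) = Num.sqrt (2 * pi).
Proof.
move=> s0 mD; rewrite -(gauss_mass_setT y s0) /gauss_mass -(setUv D).
rewrite Rintegral_setU ?setUv//.
- exact: measurableC.
- exact: integrable_heat_kernel.
- by apply/disj_setPS; rewrite setICr.
Qed.

Definition gauss_tail s d : R := Num.sqrt 2 * expR (- d ^+ 2 / (4 * s)).

(** Half of the exponent is spent on the tail factor, the other half leaves a
    Gaussian of twice the variance. *)
Lemma gauss_mass_far s d y D : 0 < s -> 0 <= d -> measurable D ->
    (forall x, D x -> d <= `|y - x|) ->
  gauss_mass s y D <= gauss_tail s d * gauss_mass (2 * s) y D.
Proof.
move=> s0 d0 mD far; have s20 : 0 < 2 * s by lra.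
rewrite -RintegralZl//; last exact: integrable_heat_kernel.
apply: le_Rintegral => //.
- exact: integrable_heat_kernel.
- exact: (integrableZl mD (gauss_tail s d) (integrable_heat_kernel y s20 mD)).
move=> x /far dx; rewrite /gauss_tail /heat_kernel sqrtrM//.
set z := y - x in dx *.
have n2 : Num.sqrt (2 : R) != 0 by rewrite gt_eqF// sqrtr_gt0.
have ns : Num.sqrt s != 0 by rewrite gt_eqF// sqrtr_gt0.
have -> : Num.sqrt 2 * expR (- d ^+ 2 / (4 * s)) *
    (expR (- z ^+ 2 / (2 * (2 * s))) / (Num.sqrt 2 * Num.sqrt s)) =
    expR (- d ^+ 2 / (4 * s)) * expR (- z ^+ 2 / (2 * (2 * s))) / Num.sqrt s.
  by field; rewrite ?n2 ?ns ?(gt_eqF s0).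
rewrite ler_wpM2r ?invr_ge0 ?sqrtr_ge0// -expRD ler_expR.
have -> : - z ^+ 2 / (2 * s) = - z ^+ 2 / (4 * s) + - z ^+ 2 / (2 * (2 * s)).
  by field; rewrite gt_eqF.
rewrite lerD2r !mulNr lerN2 ler_wpM2r ?invr_ge0 ?mulr_ge0 ?(ltW s0)//.
by rewrite -(real_normK (num_real z)) lerXn2r ?nnegrE.
Qed.

Lemma gauss_mass_near s d y D : 0 < s -> 0 <= d -> measurable D ->
    (forall x, `|y - x| < d -> D x) ->
  (1 - gauss_tail s d) * Num.sqrt (2 * pi) <= gauss_mass s y D.
Proof.
move=> s0 d0 mD near; have s20 : 0 < 2 * s by lra.
have mDC : measurable (~` D) by exact: measurableC.
have := @gauss_mass_far s d y (~` D) s0 d0 mDC.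
have H x : (~` D) x -> d <= `|y - x| by move=> nDx; rewrite leNgt; apply/negP => /near.
move=> /(_ H) far.
have E1 := gauss_massC y s0 mD; have E2 := gauss_massC y s20 mD.
have := gauss_mass_ge0 (2 * s) y D.
have : 0 <= gauss_tail s d by rewrite mulr_ge0 ?sqrtr_ge0 ?expR_ge0.
by move: E1 E2 far; set p := Num.sqrt _; nra.
Qed.

Lemma gauss_mass_le s y D : 0 < s -> measurable D -> gauss_mass s y D <= Num.sqrt (2 * pi).
Proof. by move=> s0 mD; rewrite -(gauss_massC y s0 mD) lerDl gauss_mass_ge0. Qed.

Lemma gauss_tail_small d t : 0 < d -> 0 < t -> exists2 s, 0 < s & gauss_tail s d <= t.
Proof.
move=> d0 t0; exists (t * d ^+ 2 / 8); first by rewrite !(divr_gt0, mulr_gt0, exprn_gt0).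
rewrite /gauss_tail; set z := - d ^+ 2 / _.
have -> : z = - (2 / t) by rewrite /z; field; rewrite !gt_eqF.
rewrite expRN -ler_pdivlMr ?invr_gt0 ?expR_gt0// invrK.
apply: (@le_trans _ _ 2).
  rewrite -[leRHS](@ger0_norm _ 2)// -sqrtr_sqr ler_wsqrtr//.
  by rewrite expr2; lra.
apply: (@le_trans _ _ (t * (2 / t))); first by rewrite mulrCA divff ?gt_eqF// mulr1.
by rewrite ler_wpM2l ?(ltW t0)//; apply: le_trans (expR_ge1Dx _); rewrite lerDr.
Qed.

Lemma mean_gauss_mass s (M : nat) (S : nat -> R) D : 0 < s -> measurable D ->
  mean M (fun j => gauss_mass s (S j) D) =
  \int[mu]_(x in D) mean M (fun j => heat_kernel s (S j - x)) /\
  mu.-integrable D (fun x => (mean M (fun j => heat_kernel s (S j - x)))%:E).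
Proof.
move=> s0 mD.
suff [E I] : \sum_(0 <= j < M) gauss_mass s (S j) D =
    \int[mu]_(x in D) (\sum_(0 <= j < M) heat_kernel s (S j - x)) /\
    mu.-integrable D (fun x => (\sum_(0 <= j < M) heat_kernel s (S j - x))%:E).
  split; first by rewrite /mean RintegralZr// E.
  exact: (integrableZr mD (M%:R^-1) I).
elim: M => [|M [IH1 IH2]].
  split.
    rewrite big_geq//; under eq_Rintegral do rewrite big_geq//.
    by rewrite Rintegral_cst// mul0r.
  by under eq_fun do rewrite big_geq//; exact: integrable0.
have ih := integrable_heat_kernel (S M) s0 mD.
split.
  under eq_Rintegral do rewrite big_nat_recr//=.
  by rewrite big_nat_recr//= RintegralD// IH1.
under eq_fun do rewrite big_nat_recr//=.
exact: (integrableD mD IH2 ih).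
Qed.

Lemma mean_gauss_mass_close s (M : nat) (S : nat -> R) D (A e : R) :
    0 < s -> measurable D -> (mu D < +oo)%E ->
    (forall x, D x -> `|A * mean M (fun j => heat_kernel s (S j - x)) - 1| <= e) ->
  `|A * mean M (fun j => gauss_mass s (S j) D) - fine (mu D)| <= e * fine (mu D).
Proof.
move=> s0 mD Dfin close; have [E I] := mean_gauss_mass M S s0 mD.
rewrite E -RintegralZl// -[fine (mu D) in X in `|_ - X|]mul1r.
apply: Rintegral_near_cst => //; exact: (integrableZl mD A I).
Qed.

End GaussMass.

(** * From Gaussians to counts of cells *)

Section Smoothing.
Variables (R : realType) (M : nat -> nat) (S : nat -> nat -> R) (A : nat -> R).
Local Notation mu := (@lebesgue_measure R).
Implicit Types (D : set (measurableTypeR R)) (E : set R).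

Hypothesis A0 : forall n, 0 <= A n.
Hypothesis heat_limit : forall s r e : R, 0 < s -> 0 < e ->
  \forall n \near \oo, forall x, `|x| <= r ->
    `|A n * mean (M n) (fun j => heat_kernel s (S n j - x)) - 1| <= e.

Lemma gauss_mass_limit s r e D : 0 < s -> 0 < e -> measurable D ->
    (forall x, D x -> `|x| <= r) ->
  \forall n \near \oo,
    `|A n * mean (M n) (fun j => gauss_mass s (S n j) D) - fine (mu D)|
    <= e * fine (mu D).
Proof.
move=> s0 e0 mD Dr; have := heat_limit r s0 e0; apply: filterS => n hn.
apply: mean_gauss_mass_close => //; last by move=> x /Dr; exact: hn.
apply: (@le_lt_trans _ _ (mu `[- r, r]%classic)).
  apply: le_measure; rewrite ?inE//.
  by move=> x /Dr; rewrite /= in_itv/= ler_norml.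
by rewrite lebesgue_measure_itv/=; case: ifPn => // _; rewrite -EFinB ltry.
Qed.

Let sqrt2pi_gt0 : 0 < Num.sqrt (2 * pi : R).
Proof. by rewrite sqrtr_gt0 mulr_gt0 ?pi_gt0. Qed.

(** The indicator of E is at most the normalised Gaussian mass of D divided by
    1 - tail, since D contains the d-neighbourhood of E. *)
Lemma count_limsup (d r k : R) E D : 0 < d -> 0 < k -> measurable D ->
    (forall x, D x -> `|x| <= r) ->
    (forall y x, E y -> `|y - x| < d -> D x) ->
  \forall n \near \oo,
    A n * mean (M n) (fun j => \1_E (S n j)) <= fine (mu D) / Num.sqrt (2 * pi) + k.
Proof.
move=> d0 k0 mD Dr ED.
set p := Num.sqrt _; pose X := fine (mu D) / p.
have X0 : 0 <= X by rewrite divr_ge0 ?fine_ge0 ?(ltW sqrt2pi_gt0)//.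
have XE : fine (mu D) = X * p by rewrite divfK// gt_eqF.
(* For t <= 1/2, (1 + t) / (1 - t) <= 1 + 4 t; the tail factor and the relative
   error of the limit are both taken to be at most t. *)
pose t := Num.min 2^-1 (k / (4 * (X + 1))).
have t0 : 0 < t by rewrite lt_min; apply/andP; split; rewrite ?divr_gt0//; lra.
have t2 : t <= 2^-1 by rewrite ge_min lexx.
have tk : t * (4 * (X + 1)) <= k.
  by rewrite -ler_pdivlMr; [rewrite ge_min lexx orbT|lra].
have [s s0 st] := gauss_tail_small d0 t0.
have := gauss_mass_limit s0 t0 mD Dr; apply: filterS => n.
rewrite ler_norml => /andP[_]; rewrite lerBlDr => hn.
set F := mean _ _.
have hF : (1 - t) * p * F <= mean (M n) (fun j => gauss_mass s (S n j) D).
  rewrite -meanZ; apply: le_mean => j _; rewrite indicE.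
  have [Ej|nEj] := boolP (S n j \in E); last by rewrite mulr0 gauss_mass_ge0.
  rewrite mulr1; move/set_mem in Ej.
  have := @gauss_mass_near R s d (S n j) D s0 (ltW d0) mD (fun x => ED _ x Ej).
  apply: le_trans; rewrite ler_wpM2r ?(ltW sqrt2pi_gt0)// lerD2l lerN2//.
have {hn} : (1 - t) * p * (A n * F) <= X * p * (1 + t).
  rewrite mulrCA; apply: le_trans (ler_wpM2l (A0 n) hF) _.
  by apply: le_trans hn _; rewrite XE; lra.
rewrite -/X mulrAC [X * p * _]mulrAC ler_pM2r ?sqrt2pi_gt0//.
set y := A n * F => hy.
have y0 : 0 <= y by rewrite mulr_ge0// mean_ge0// => j _; rewrite indicE.
by nra.
Qed.

(** Outside E the Gaussian mass of D does not vanish, but it is at most the tail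
    factor times the mass at width 2s, and the mean of that mass also has a
    finite limit. *)
Lemma count_liminf (d r k : R) E D : 0 < d -> 0 < k -> measurable D ->
    (forall x, D x -> `|x| <= r) ->
    (forall y x, D x -> `|y - x| < d -> E y) ->
  \forall n \near \oo,
    fine (mu D) / Num.sqrt (2 * pi) - k <= A n * mean (M n) (fun j => \1_E (S n j)).
Proof.
move=> d0 k0 mD Dr ED.
set p := Num.sqrt _; pose X := fine (mu D) / p.
have X0 : 0 <= X by rewrite divr_ge0 ?fine_ge0 ?(ltW sqrt2pi_gt0)//.
have XE : fine (mu D) = X * p by rewrite divfK// gt_eqF.
pose t := Num.min 2^-1 (k / (4 * (X + 1))).
have t0 : 0 < t by rewrite lt_min; apply/andP; split; rewrite ?divr_gt0//; lra.
have t2 : t <= 2^-1 by rewrite ge_min lexx.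
have tk : t * (4 * (X + 1)) <= k.
  by rewrite -ler_pdivlMr; [rewrite ge_min lexx orbT|lra].
have [s s0 st] := gauss_tail_small d0 t0.
have s20 : 0 < 2 * s by lra.
apply: filterS2 (gauss_mass_limit s0 t0 mD Dr) (gauss_mass_limit s20 t0 mD Dr) => n.
rewrite !ler_norml => /andP[h1 _] /andP[_ h2].
set F := mean _ (fun j => \1_E _).
have hF : mean (M n) (fun j => gauss_mass s (S n j) D)
    - t * mean (M n) (fun j => gauss_mass (2 * s) (S n j) D) <= p * F.
  rewrite -!meanZ -meanB; apply: le_mean => j _; rewrite indicE.
  have gm0 := gauss_mass_ge0 (2 * s) (S n j) D.
  have [Ej|nEj] := boolP (S n j \in E).
    rewrite mulr1; apply: le_trans (gauss_mass_le (S n j) s0 mD).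
    by rewrite lerBlDr lerDl mulr_ge0// ltW.
  rewrite mulr0 subr_le0.
  apply: le_trans (@gauss_mass_far R s d (S n j) D s0 (ltW d0) mD _) _.
    move=> x Dx; rewrite leNgt; apply/negP => /(ED _ _ Dx) Ej.
    by move: nEj; rewrite mem_set.
  by rewrite ler_wpM2r.
have := ler_wpM2l (A0 n) hF; rewrite mulrBr.
move: h1 h2; rewrite XE.
set G1 := A n * mean _ _; set G2 := mean _ _ => h1 h2 h3.
have h4 : A n * G2 <= X * p * (1 + t) by lra.
have h5 : (X - t * X - t * (1 + t) * X) * p <= A n * F * p.
  have := ler_wpM2l (ltW t0) h4; lra.
move: h5; rewrite ler_pM2r ?sqrt2pi_gt0// => h5.
rewrite mulfK ?gt_eqF//; apply: le_trans h5; nra.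
Qed.

End Smoothing.

(** * Cells and Lebesgue measure *)

Section Cells.
Variable R : realType.
Local Notation mu := (@lebesgue_measure R).

(** Valid for arbitrary sets, on which the Lebesgue measure is the outer measure. *)
Lemma lebesgue_measure_le (A B : set R) : A `<=` B -> (mu A <= mu B)%E.
Proof. by move=> AB; apply: le_outer_measure. Qed.

Definition cell (M j : nat) : set R := `[j%:R / M%:R, j.+1%:R / M%:R[%classic.

Lemma cellE (M j : nat) (x : R) : (0 < M)%N ->
  cell M j x <-> j%:R <= M%:R * x < j.+1%:R.
Proof.
move=> M0; have M0' : 0 < M%:R :> R by rewrite ltr0n.
by rewrite /cell/= in_itv/= ler_pdivrMr// ltr_pdivlMr// ![x * _]mulrC.
Qed.

Lemma lebesgue_measure_cell (M j : nat) : (0 < M)%N -> mu (cell M j) = (M%:R^-1)%:E.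
Proof.
move=> M0; have M0' : 0 < M%:R :> R by rewrite ltr0n.
rewrite lebesgue_measure_itv/= lte_fin ltr_pM2r ?invr_gt0// ltr_nat ltnSn.
by rewrite -EFinB -mulrBl -natrB// subSnn mul1r.
Qed.

Lemma cell_cover (M : nat) (x : R) : (0 < M)%N -> x \in `[0, 1[ ->
  exists2 j, (j < M)%N & cell M j x.
Proof.
move=> M0; have M0' : 0 < M%:R :> R by rewrite ltr0n.
rewrite in_itv/= => /andP[x0 x1].
have Mx0 : 0 <= M%:R * x by rewrite mulr_ge0// ltW.
exists (Num.truncn (M%:R * x)); last by apply/cellE => //; exact: truncn_itv.
rewrite -(ltr_nat R); apply: le_lt_trans (_ : M%:R * x < _).
  by have /andP[] := truncn_itv Mx0.
by rewrite -[ltRHS]mulr1 ltr_pM2l.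
Qed.

(** Disjoint cells: the measure of their union is a count.  Built by recursion
    on the number k of cells inspected. *)
Lemma cell_union (M : nat) (p : pred nat) (k : nat) : (0 < M)%N ->
  exists U : set (measurableTypeR R), [/\ measurable U,
    U `<=` [set x | 0 <= x < k%:R / M%:R],
    mu U = ((\sum_(0 <= j < k) (p j)%:R) / M%:R)%:E &
    forall j x, (j < k)%N -> cell M j x -> U x <-> p j].
Proof.
move=> M0; have M0' : 0 < M%:R :> R by rewrite ltr0n.
elim: k => [|k [U [mU Uk muU Up]]].
  exists set0; split => //; first by rewrite measure0 big_geq// mul0r.
exists (U `|` (if p k then cell M k else set0)).
have mc : measurable (if p k then cell M k else set0 : set (measurableTypeR R)).
  by case: ifP => _ //; exact: measurable_itv.
have kk : k%:R / M%:R <= k.+1%:R / M%:R :> R by rewrite ler_wpM2r ?invr_ge0// ler_nat.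
split.
- exact: measurableU.
- move=> x [/Uk/=/andP[x0 xk]|]; first by rewrite x0/= (lt_le_trans xk).
  case: ifP => // _; rewrite /cell/= in_itv/= => /andP[xk ->]; rewrite andbT.
  by apply: le_trans xk; rewrite divr_ge0.
- rewrite measureU//; last first.
    rewrite -subset0 => x [/Uk/=/andP[_ xk]].
    case: ifP => // _; rewrite /cell/= in_itv/= => /andP[kx _].
    by move: (lt_le_trans xk kx); rewrite ltxx.
  rewrite [X in (X + _)%E = _](_ : _ = mu U)// muU big_nat_recr//= mulrDl EFinD.
  congr (_ + _)%E; case: (p k); last by rewrite measure0 mul0r.
  by rewrite mul1r; exact: lebesgue_measure_cell.
- move=> j x; rewrite ltnS leq_eqVlt => /predU1P[->|jk] cx.
    split=> [[/Uk/=/andP[_ xk]|]|pk].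
    + move: cx; rewrite /cell/= in_itv/= => /andP[kx _].
      by move: (lt_le_trans xk kx); rewrite ltxx.
    + by case: ifP.
    + by right; rewrite pk.
  rewrite -(Up j x jk cx); split=> [[]//|Ux]; last by left.
  case: ifP => // _; move: cx; rewrite /cell/= !in_itv/= => /andP[_ xj] /andP[kx _].
  have : j.+1%:R / M%:R <= k%:R / M%:R :> R by rewrite ler_wpM2r ?invr_ge0// ler_nat.
  by move=> /(lt_le_trans xj)/lt_le_trans/(_ kx); rewrite ltxx.
Qed.

Lemma le_measure_cells (M : nat) (E P : set R) (S : nat -> R) : (0 < M)%N ->
    (forall j x, (j < M)%N -> cell M j x -> P x -> E (S j)) ->
  (mu [set x | x \in `[0%R, 1%R] /\ P x] <= (mean M (fun j => \1_E (S j)))%:E)%E.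
Proof.
move=> M0 PE; have [U [mU _ muU UE]] := cell_union (fun j => S j \in E) M M0.
rewrite /mean; under eq_bigr do rewrite indicE; rewrite -muU.
apply: (@le_trans _ _ (mu (U `|` [set 1]))).
  apply: lebesgue_measure_le => x [xI Px].
  have [->|x1] := eqVneq x 1; first by right.
  have /(cell_cover M0)[j jM cx] : x \in `[0, 1[.
    by move: xI; rewrite !in_itv/= lt_neqAle x1.
  by left; apply/(UE _ _ jM cx)/mem_set; exact: PE cx Px.
apply: le_trans (measureU2 _ _ _) _ => //.
rewrite [X in (_ + X <= _)%E](_ : _ = 0%E) ?adde0//.
exact: lebesgue_measure_set1.
Qed.

Lemma ge_measure_cells (M : nat) (E P : set R) (S : nat -> R) : (0 < M)%N ->
    (forall j x, (j < M)%N -> cell M j x -> E (S j) -> P x) ->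
  ((mean M (fun j => \1_E (S j)))%:E <= mu [set x | x \in `[0%R, 1%R] /\ P x])%E.
Proof.
move=> M0 PE; have [U [mU U1 muU UE]] := cell_union (fun j => S j \in E) M M0.
rewrite /mean; under eq_bigr do rewrite indicE; rewrite -muU.
apply: lebesgue_measure_le => x Ux; have /= := U1 _ Ux.
rewrite divff ?pnatr_eq0 -?lt0n// => /andP[x0 x1].
have xI : x \in `[0, 1[ by rewrite in_itv/= x0.
have [j jM cx] := cell_cover M0 xI.
split; first by rewrite in_itv/= x0 ltW.
by apply: (PE _ _ jM cx); apply/set_mem; exact/(UE _ _ jM cx).
Qed.

End Cells.

(** * Digits of a periodic Hoelder function *)

Section Riemann.
Variables (R : realType) (F : R -> R) (w : R) (b : nat).
Local Notation mu := (@lebesgue_measure R).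
Hypothesis b0 : (0 < b)%N.
Hypothesis iF : mu.-integrable `[0, 1]%classic (EFin \o F).
Hypothesis wF : forall d x, (d < b)%N -> cell b d (x : R) -> `|F x - F (d%:R / b%:R)| <= w.

Lemma riemann_sum_close :
  `|mean b (fun d => F (d%:R / b%:R)) - \int[mu]_(x in `[0, 1]) F x| <= w.
Proof.
have b0' : 0 < b%:R :> R by rewrite ltr0n.
have main k : (k <= b)%N ->
    `|\int[mu]_(x in `[0%R, k%:R / b%:R[) F x
      - (\sum_(0 <= d < k) F (d%:R / b%:R)) / b%:R| <= w * (k%:R / b%:R).
  elim: k => [_|k IH kb].
    by rewrite big_geq// !mul0r mulr0 set_itvco0 Rintegral_set0 subrr normr0.
  have kk : k%:R / b%:R <= k.+1%:R / b%:R :> R by rewrite ler_wpM2r ?invr_ge0// ler_nat.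
  have k0 : 0 <= k%:R / b%:R :> R by rewrite divr_ge0.
  have kb1 : k.+1%:R / b%:R <= 1 :> R by rewrite ler_pdivrMr// mul1r ler_nat.
  have UE : `[0, (k.+1%:R / b%:R)[%classic =
      `[0, (k%:R / b%:R)[%classic `|` cell b k :> set R.
    rewrite /cell; apply/seteqP; split => x /=; rewrite !in_itv/=.
      by move=> /andP[x0 xk]; have [xlt|xge] := ltP x (k%:R / b%:R);
        [left; rewrite x0|right].
    move=> [/andP[x0 xk]|/andP[xk1 xk]]; first by rewrite x0 (lt_le_trans xk).
    by rewrite xk (le_trans k0).
  have sub1 : (`[0, (k.+1%:R / b%:R)[%classic : set R) `<=` `[0, 1]%classic.
    move=> x /=; rewrite !in_itv/= => /andP[-> /ltW xk]; exact: le_trans kb1.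
  have iFk : mu.-integrable (`[0, (k%:R / b%:R)[%classic `|` cell b k) (EFin \o F).
    by rewrite -UE; apply: integrableS iF => //; exact: measurable_itv.
  have mc : measurable (cell b k : set (measurableTypeR R)) by exact: measurable_itv.
  rewrite UE Rintegral_setU//; last first.
    apply/disj_setPS => x [] /=; rewrite /cell/= !in_itv/= => /andP[_ xk] /andP[kx _].
    by move: (lt_le_trans xk kx); rewrite ltxx.
  have muc := lebesgue_measure_cell R k b0.
  have : `|\int[mu]_(x in cell b k) F x - F (k%:R / b%:R) * fine (mu (cell b k))|
      <= w * fine (mu (cell b k)).
    apply: Rintegral_near_cst => //.
    - have : (mu (cell b k) < +oo)%E by rewrite muc ltry.
      exact.
    - by apply: integrableS iFk => //; exact: measurableU.
    - by move=> x; exact: wF.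
  rewrite muc/= big_nat_recr//= => h1.
  have {IH} h2 := IH (ltnW kb).
  set I1 := \int[mu]_(x in _) F x in h2 *; set I2 := \int[mu]_(x in cell _ _) F x in h1 *.
  set s := \sum_(0 <= i < k) _ in h2 *.
  have -> : I1 + I2 - (s + F (k%:R / b%:R)) / b%:R =
    (I1 - s / b%:R) + (I2 - F (k%:R / b%:R) / b%:R) by ring.
  apply: le_trans (ler_normD _ _) _; apply: le_trans (lerD h2 h1) _.
  by rewrite -mulrDr -[b%:R^-1 in X in _ * (_ + X)]mul1r -mulrDl natr1.
have := main b (leqnn b); rewrite divff ?gt_eqF// mulr1 distrC.
rewrite Rintegral_itv_bndo_bndc//; apply: integrableS iF => //.
by move=> x /=; rewrite !in_itv/= => /andP[-> /ltW].
Qed.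

End Riemann.

Section Holder.
Variables (R : realType) (f : R -> R) (h alpha : R).
Local Notation mu := (@lebesgue_measure R).
Hypothesis alpha_gt0 : 0 < alpha.
Hypothesis f_holder : forall x y : R, x <> y -> `|f x - f y| <= h * `|x - y| `^ alpha.

Lemma holder_cst_ge0 : 0 <= h.
Proof.
have := @f_holder 0 1; rewrite sub0r normrN1 powR1 mulr1 => hh.
by apply: le_trans (hh _) => // /esym /eqP; rewrite oner_eq0.
Qed.

Lemma holder_le (x y d : R) : `|x - y| <= d -> `|f x - f y| <= h * d `^ alpha.
Proof.
move=> xyd; have [->|/eqP xy] := eqVneq x y.
  by rewrite subrr normr0 mulr_ge0 ?powR_ge0 ?holder_cst_ge0.
apply: le_trans (f_holder xy) _; rewrite ler_wpM2l ?holder_cst_ge0//.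
by rewrite ge0_ler_powR ?nnegrE ?(ltW alpha_gt0)// (le_trans _ xyd).
Qed.

Lemma holder_continuous : continuous f.
Proof.
move=> x; apply/cvgrPdist_le => /= e e0.
have h1 : 0 < h + 1 by rewrite ltr_wpDl ?holder_cst_ge0.
pose d := (e / (h + 1)) `^ alpha^-1.
have d0 : 0 < d by apply: powR_gt0; rewrite divr_gt0.
near=> y; apply: le_trans (holder_le (_ : _ <= d)) _.
  by near: y; apply: cvgr_dist_le => //; exact: cvg_id.
rewrite /d -powRrM mulVf ?gt_eqF// powRr1 ?divr_ge0 ?(ltW e0) ?(ltW h1)//.
by rewrite mulrCA ler_piMr ?(ltW e0)// ler_pdivrMr// mul1r lerDl.
Unshelve. all: by end_near.
Qed.

Lemma holder_bounded (x : R) : 0 <= x <= 1 -> `|f x| <= `|f 0| + h.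
Proof.
move=> /andP[x0 x1]; rewrite -[f x](subrK (f 0)) addrC.
apply: le_trans (ler_normD _ _) _; rewrite lerD2l.
have := @holder_le x 0 1; rewrite powR1 mulr1; apply.
by rewrite subr0 ger0_norm.
Qed.

Lemma holder_integrable : mu.-integrable `[0, 1]%classic (EFin \o f).
Proof.
apply: continuous_compact_integrable; first exact: segment_compact.
by apply: continuous_subspaceT; exact: holder_continuous.
Qed.

Lemma holder_sqr_integrable :
  mu.-integrable `[0, 1]%classic (EFin \o (fun x => f x ^+ 2)).
Proof.
apply: continuous_compact_integrable; first exact: segment_compact.
apply: continuous_subspaceT => x; apply: cvgM; exact: holder_continuous.
Qed.

Hypothesis f_mean : \int[mu]_(x in `[0%R, 1%R]) f x = 0.
Hypothesis f_var : \int[mu]_(x in `[0%R, 1%R]) (f x ^+ 2) = 1.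

(** Subtracting the mean over d makes the digit variables exactly centred; by
    [mean_digit_le] it moves them by no more than the Hoelder gap. *)
Definition centered_digit (b d : nat) : R :=
  f (d%:R / b%:R) - mean b (fun d => f (d%:R / b%:R)).

(** Bound for the oscillation of f over an interval of length 1 / b. *)
Definition holder_gap (b : nat) : R := h / b%:R `^ alpha.

Section Digit.
Variable b : nat.
Hypothesis b0 : (0 < b)%N.
Let K : R := `|f 0| + h.
Let g d : R := f (d%:R / b%:R).

Lemma holder_gap_ge0 : 0 <= holder_gap b.
Proof. by rewrite divr_ge0 ?powR_ge0 ?holder_cst_ge0. Qed.

Lemma holder_gapE : h * (b%:R^-1) `^ alpha = holder_gap b.
Proof.
have b0' : 0 < b%:R :> R by rewrite ltr0n.
have bp : b%:R `^ alpha != 0 by rewrite gt_eqF// powR_gt0.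
congr (_ * _); apply: (mulIf bp).
rewrite mulVf// -powRM ?invr_ge0// mulVf ?gt_eqF//. by rewrite powR1.
Qed.

Lemma cell_dist (d : nat) (x : R) : cell b d x -> `|x - d%:R / b%:R| <= b%:R^-1.
Proof.
have b0' : 0 < b%:R :> R by rewrite ltr0n.
rewrite /cell/= in_itv/= => /andP[x1 x2].
rewrite ger0_norm ?subr_ge0// lerBlDr; apply: le_trans (ltW x2) _.
by rewrite -natr1 mulrDl mul1r addrC.
Qed.

Lemma cell_holder (d : nat) (x : R) : cell b d x -> `|f x - g d| <= holder_gap b.
Proof. by move=> /cell_dist /holder_le; rewrite holder_gapE. Qed.

Lemma digit_unit (d : nat) : (d < b)%N -> 0 <= (d%:R / b%:R : R) <= 1.
Proof.
move=> db; rewrite divr_ge0//= ler_pdivrMr ?ltr0n// mul1r ler_nat; exact: ltnW.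
Qed.

Lemma digit_bounded (d : nat) : (d < b)%N -> `|g d| <= K.
Proof. by move=> /digit_unit; exact: holder_bounded. Qed.

(** A Riemann sum of f, whose integral is 0. *)
Lemma mean_digit_le : `|mean b g| <= holder_gap b.
Proof.
rewrite -[mean b g]subr0 -f_mean.
by apply: riemann_sum_close => //; [exact: holder_integrable|move=> d x _; exact: cell_holder].
Qed.

Lemma mean_sqr_digit_le : `|mean b (fun d => g d ^+ 2) - 1| <= 2 * K * holder_gap b.
Proof.
rewrite -[X in `|_ - X|]f_var; apply: (@riemann_sum_close R (fun x => f x ^+ 2)) => //.
  exact: holder_sqr_integrable.
move=> d x db cx; rewrite subr_sqr mulrC normrM.
apply: ler_pM => //; last exact: cell_holder.
apply: le_trans (ler_normD _ _) _; rewrite [leRHS]mulr_natl [leRHS]mulr2n; apply: lerD.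
  apply: holder_bounded; have := digit_unit db.
  move: cx; rewrite /cell/= in_itv/= => /andP[x1 x2] /andP[d0 d1].
  rewrite (le_trans d0 x1)/= ltW//; apply: lt_le_trans x2 _.
  by rewrite ler_pdivrMr ?ltr0n// mul1r ler_nat.
exact: digit_bounded.
Qed.

Lemma centered_digit_mean0 : mean b (centered_digit b) = 0.
Proof. by rewrite meanB mean_cst// subrr. Qed.

Lemma centered_digit_bounded (d : nat) : (d < b)%N -> `|centered_digit b d| <= 2 * K.
Proof.
move=> db; apply: le_trans (ler_normB _ _) _; rewrite [leRHS]mulr_natl [leRHS]mulr2n.
apply: lerD; first exact: digit_bounded.
by apply: mean_norm_le => // e eb; exact: digit_bounded.
Qed.

Lemma centered_digit_var :
  `|mean b (fun d => centered_digit b d ^+ 2) - 1| <= 3 * K * holder_gap b.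
Proof.
set p := mean b g.
have -> : mean b (fun d => centered_digit b d ^+ 2) - 1 =
    (mean b (fun d => g d ^+ 2) - 1) - p ^+ 2.
  transitivity (mean b (fun d => g d ^+ 2 - (2 * p) * g d + p ^+ 2) - 1).
    by congr (_ - 1); apply: eq_mean => d _; rewrite /centered_digit -/p /g; ring.
  by rewrite meanD meanB meanZ mean_cst// -/p; ring.
apply: le_trans (ler_normB _ _) _.
have -> : 3 * K * holder_gap b = 2 * K * holder_gap b + K * holder_gap b by ring.
apply: lerD; first exact: mean_sqr_digit_le.
rewrite normrX expr2; apply: ler_pM => //; last exact: mean_digit_le.
by apply: mean_norm_le => // d; exact: digit_bounded.
Qed.

Lemma cell_centered_digit (d : nat) (x : R) : cell b d x ->
  `|f x - centered_digit b d| <= 2 * holder_gap b.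
Proof.
move=> cx; rewrite /centered_digit opprB addrCA addrC.
apply: le_trans (ler_normD _ _) _; rewrite [leRHS]mulr_natl [leRHS]mulr2n.
by apply: lerD; [exact: cell_holder|exact: mean_digit_le].
Qed.

End Digit.

Hypothesis f_per : forall x, f (x + 1) = f x.

Lemma periodic_nat (n : nat) (x : R) : f (x + n%:R) = f x.
Proof. by elim: n => [|n IH]; rewrite ?addr0// -natr1 addrA f_per. Qed.

(** With b = b_(n+1): if x lies in the cell j of mesh 1 / m_(n+2), then it lies in
    the cell j / b of mesh 1 / m_(n+1), while m_(n+1) x, up to an integer that
    periodicity discards, lies in the cell j mod b of mesh 1 / b. *)
Lemma cell_digit_sum (m b : nat -> nat) (c : nat -> R) (n : nat) :
    (forall k, (1 <= k)%N -> (0 < m k)%N /\ (0 < b k)%N) ->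
    (forall k, (1 <= k)%N -> m k.+1 = (m k * b k)%N) ->
  forall (j : nat) (x : R), cell (m n.+1) j x ->
  `|\sum_(1 <= k < n.+1) c k * f ((m k)%:R * x)
     - digit_sum b (fun k d => c k * centered_digit (b k) d) n j|
  <= \sum_(1 <= k < n.+1) `|c k| * (2 * holder_gap (b k)).
Proof.
move=> mb0 mrec; elim: n => [j x _|n IH j x cx].
  by rewrite !big_geq//= subrr normr0.
have [m0 b0] := mb0 n.+1 isT; have [m20 _] := mb0 n.+2 isT.
have b0' : 0 < (b n.+1)%:R :> R by rewrite ltr0n.
rewrite (@big_nat_recr _ _ _ n.+1)//= [leRHS](@big_nat_recr _ _ _ n.+1)//= opprD addrACA.
apply: le_trans (ler_normD _ _) _; move/cellE : cx => /(_ m20).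
rewrite mrec// natrM mulrAC.
set X := (m n.+1)%:R * x; set q := (j %/ b n.+1)%N; set d := (j %% b n.+1)%N => /andP[j1 j2].
have jE : j%:R = q%:R * (b n.+1)%:R + d%:R :> R by rewrite -natrM -natrD -divn_eq.
have dlt : d.+1%:R <= (b n.+1)%:R :> R by rewrite ler_nat ltn_mod.
apply: lerD.
  apply: IH; apply/cellE => //; rewrite -/X; apply/andP; split.
    rewrite -(ler_pM2r b0'); apply: le_trans j1; rewrite jE lerDl//.
  rewrite -(ltr_pM2r b0'); apply: lt_le_trans j2 _.
  by rewrite -!natr1 in dlt *; rewrite jE mulrDl mul1r -addrA lerD2l.
rewrite -mulrBr normrM ler_wpM2l//.
rewrite -(subrK q%:R X) periodic_nat; apply: cell_centered_digit => //.
apply/cellE => //; rewrite mulrBr [_ * X]mulrC; apply/andP; split.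
  by move: j1; rewrite jE; lra.
by move: j2; rewrite -!natr1 jE; lra.
Qed.

End Holder.

(** * Margins of elementary sets *)

Section Elementary.
Variable R : realType.
Local Notation mu := (@lebesgue_measure R).

(** The cost k of the margins is stated for differences of sets because that form
    is stable under unions, even overlapping ones. *)
Definition margin_sets (E D1 D2 : set (measurableTypeR R)) (d k r : R) : Prop :=
  [/\ measurable D1, measurable D2,
      (forall x, D2 x -> `|x| <= r),
      (forall x y, D1 x -> `|y - x| < d -> E y) /\
      (forall x y, E x -> `|y - x| < d -> D2 y) &
      (mu (E `\` D1) <= k%:E)%E /\ (mu (D2 `\` E) <= k%:E)%E].

(** A bounded interval may have infinite bounds when it is empty. *)
Lemma bounded_itv (i : interval R) : bounded_set [set` i] ->
  [set` i] = set0 \/ exists l r, [/\ l <= r, (`]l, r[ `<=` [set` i])%classic &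
    ([set` i] `<=` `[l, r])%classic].
Proof.
move=> bi; have [->|/set0P[x xi]] := eqVneq [set` i] set0; [by left|right].
case: bi => M [_ /(_ (M + 1))]; rewrite ltrDl => /(_ ltr01) bi.
have bnd y : [set` i] y -> `|y| <= M + 1 by exact: bi.
case: i xi bi bnd => -[b1 l|[]] -[b2 r|[]] /= xi _ bnd; try by move: xi; rewrite ?in_itv/= ?andbF.
- exists l, r; split.
  + move: xi; case: b1 b2 {bnd} => [] []; rewrite in_itv/= => /andP[u v]; lra.
  + move=> y /=; rewrite !in_itv/= => /andP[ly yr].
    by case: b1 b2 {xi bnd} => [] []; apply/andP; split; rewrite /=; lra.
  + move=> y /=; rewrite !in_itv/=.
    by case: b1 b2 {xi bnd} => [] [] /andP[] /= ly yr; apply/andP; split; lra.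
- have [u [u0 uM xu]] : exists u : R, [/\ 0 <= u, M + 1 < u & x < u].
    exists (`|x| + `|M| + 2).
    by have := ler_norm x; have := ler_norm M; have := normr_ge0 x; have := normr_ge0 M;
      split; lra.
  have := bnd u; rewrite (ger0_norm u0) => h.
  have /h : u \in Interval (BSide b1 l) +oo%O; last by lra.
  by move: xi; rewrite !in_itv/= !andbT; case: b1 {bnd h} => /= ?; lra.
- have [u [u0 uM xu]] : exists u : R, [/\ 0 <= u, M + 1 < u & - x < u].
    exists (`|x| + `|M| + 2).
    by have := ler_norm (- x); have := ler_norm M; have := normr_ge0 x;
      have := normr_ge0 M; rewrite normrN; split; lra.
  have := bnd (- u); rewrite normrN (ger0_norm u0) => h.
  have /h : - u \in Interval -oo%O (BSide b2 r); last by lra.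
  by move: xi; rewrite !in_itv/=; case: b2 {bnd h} => /= ?; lra.
- have := bnd (`|M| + 2).
  rewrite in_itv/= => /(_ isT); rewrite ger0_norm ?addr_ge0//.
  by have := ler_norm M; lra.
Qed.

Lemma margin_sets_itv (i : interval R) (k : R) : bounded_set [set` i] -> 0 < k ->
  exists D1 D2 d r, 0 < d /\ margin_sets [set` i] D1 D2 d k r.
Proof.
move=> bi k0; have [->|[l [r [lr sub1 sub2]]]] := bounded_itv bi.
  exists set0, set0, 1, 0; split => //; split => //.
  by rewrite !setDv measure0; split; rewrite lee_fin ltW.
pose d := k / 2; have d0 : 0 < d by rewrite divr_gt0.
have two (a b : R) (A : set R) : A `<=` `[a, a + d]%classic `|` `[b, b + d]%classic ->
    (mu A <= k%:E)%E.
  move=> AU; apply: le_trans (lebesgue_measure_le AU) _.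
  apply: le_trans (measureU2 _ _ _) _ => //.
  have muI (c : R) : (mu `[c, (c + d)%R]%classic <= d%:E)%E.
    by rewrite lebesgue_measure_itv/= lte_fin ltrDl d0 -EFinB [c + d]addrC addrK.
  have -> : k%:E = (d%:E + d%:E)%E by rewrite -EFinD /d; congr EFin; field.
  by apply: leeD; exact: muI.
exists `[l + d, r - d]%classic, `]l - d, r + d[%classic, d, (`|l| + `|r| + d); split => //.
split.
- exact: measurable_itv.
- exact: measurable_itv.
- move=> x /=; rewrite in_itv/= => /andP[x1 x2].
  have := ler_norm l; have := ler_norm (- l); have := ler_norm r; have := ler_norm (- r).
  rewrite !normrN => ? ? ? ?; rewrite ler_norml; apply/andP; split; lra.
- split=> x y.
    rewrite /= in_itv/= => /andP[x1 x2]; rewrite ltr_norml => /andP[y1 y2].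
    by apply: sub1; rewrite /= in_itv/=; apply/andP; split; lra.
  move=> /sub2; rewrite /= !in_itv/= => /andP[x1 x2].
  by rewrite ltr_norml => /andP[y1 y2]; apply/andP; split; lra.
split.
- apply: (two l (r - d)) => x [/sub2]; rewrite /= !in_itv/= => /andP[x1 x2].
  move=> /negP; rewrite negb_and -!ltNge => /orP[h|h].
    by left; apply/andP; split; lra.
  by right; apply/andP; split; lra.
- apply: (two (l - d) r) => x [+ nx]; rewrite /= !in_itv/= => /andP[x1 x2].
  have [xl|lx] := leP x l; first by left; apply/andP; split; lra.
  have [rx|xr] := leP r x; first by right; apply/andP; split; lra.
  by exfalso; apply: nx; apply: sub1; rewrite /= in_itv/= lx.
Qed.

Lemma margin_setsU (E E' D1 D1' D2 D2' : set (measurableTypeR R)) (d d' k k' r r' : R) :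
    measurable E -> measurable E' ->
    margin_sets E D1 D2 d k r -> margin_sets E' D1' D2' d' k' r' ->
  margin_sets (E `|` E') (D1 `|` D1') (D2 `|` D2')
    (Num.min d d') (k + k') (Num.max r r').
Proof.
move=> mE mE' [m1 m2 b [p1 p2] [q1 q2]] [m1' m2' b' [p1' p2'] [q1' q2']]; split.
- exact: measurableU.
- exact: measurableU.
- by move=> x [/b|/b'] h; rewrite le_max h ?orbT.
- split=> x y; rewrite lt_min => -[h|h] /andP[h1 h2].
  + by left; exact: p1 h _.
  + by right; exact: p1' h _.
  + by left; exact: p2 h _.
  + by right; exact: p2' h _.
split; rewrite EFinD.
- apply: (@le_trans _ _ (mu ((E `\` D1) `|` (E' `\` D1')))).
    apply: lebesgue_measure_le => x [[Ex|Ex] nx].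
      by left; split=> // ?; apply: nx; left.
    by right; split=> // ?; apply: nx; right.
  apply: le_trans (measureU2 _ _ _) _; [exact: measurableD|exact: measurableD|].
  exact: leeD.
- apply: (@le_trans _ _ (mu ((D2 `\` E) `|` (D2' `\` E')))).
    apply: lebesgue_measure_le => x [[Ex|Ex] nx].
      by left; split=> // ?; apply: nx; left.
    by right; split=> // ?; apply: nx; right.
  apply: le_trans (measureU2 _ _ _) _; [exact: measurableD|exact: measurableD|].
  exact: leeD.
Qed.

Lemma elementary_margin (E : set (measurableTypeR R)) (k : R) : elementary_set E -> 0 < k ->
  measurable E /\
  exists D1 D2 d r, 0 < d /\ margin_sets E D1 D2 d k r.
Proof.
move=> [s bs ->]; elim: s bs k => [|i s IH] bs k k0.
  have -> : [set x : R | exists2 i : interval R, i \in [::] & x \in i] = set0.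
    by rewrite -subset0 => x [].
  split => //; exists set0, set0, 1, 0; split => //; split => //.
  by rewrite !setDv measure0; split; rewrite lee_fin ltW.
have -> : [set x : R | exists2 j : interval R, j \in i :: s & x \in j] =
    [set` i] `|` [set x : R | exists2 j : interval R, j \in s & x \in j].
  apply/seteqP; split => x /=.
    move=> [j]; rewrite inE => /predU1P[->|js] xj; first by left.
    by right; exists j.
  move=> [xi|[j js xj]]; first by exists i => //; rewrite mem_head.
  by exists j => //; rewrite inE js orbT.
have k2 : 0 < k / 2 by rewrite divr_gt0.
have [j js|mE [D1 [D2 [d [r [d0 m]]]]]] := IH _ _ k2; first by apply: bs; rewrite inE js orbT.
have [|D1' [D2' [d' [r' [d0' m']]]]] := @margin_sets_itv i (k / 2) _ k2.
  by apply: bs; rewrite mem_head.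
have mi : measurable ([set` i] : set (measurableTypeR R)) by exact: measurable_itv.
split; first exact: measurableU.
exists (D1' `|` D1), (D2' `|` D2), (Num.min d' d), (Num.max r' r).
split; first by rewrite lt_min d0'.
have -> : k = k / 2 + k / 2 by field.
exact: margin_setsU.
Qed.

End Elementary.

(** * Jordan measurable sets *)

Section Jordan.
Variable R : realType.
Local Notation mu := (@lebesgue_measure R).

(** The outer measure of B lies between the two contents, hence equals both. *)
Lemma jordan_approximation (B : set R) : bounded_set B -> jordan_measurable B ->
  exists2 v : R, mu B = v%:E & forall k, 0 < k -> exists E1 E2 : set R,
    [/\ elementary_set E1 /\ elementary_set E2, E1 `<=` B, B `<=` E2,
        ((v - k)%:E <= mu E1)%E & (mu E2 <= (v + k)%:E)%E].
Proof.
move=> bB [_ io].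
have iB : (inner_jordan_content B <= mu B)%E.
  by apply: ge_ereal_sup => _ [E [_ EB] <-]; exact: lebesgue_measure_le.
have Bo : (mu B <= outer_jordan_content B)%E.
  by apply: le_ereal_inf_tmp => _ [E [_ BE] <-]; exact: lebesgue_measure_le.
have oB : outer_jordan_content B = mu B by apply/eqP; rewrite eq_le Bo -io iB.
have iE : inner_jordan_content B = mu B by rewrite io.
have B0 : (0 <= mu B)%E.
  by rewrite -(measure0 mu); apply: lebesgue_measure_le.
have Bf : mu B \is a fin_num.
  rewrite ge0_fin_numE//; case: bB => M [_ /(_ (M + 1))]; rewrite ltrDl => /(_ ltr01) bB.
  apply: (@le_lt_trans _ _ (mu `[- (M + 1), M + 1]%classic)).
    by apply: lebesgue_measure_le => x /bB; rewrite /= in_itv/= ler_norml.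
  by rewrite lebesgue_measure_itv/=; case: ifPn => // _; rewrite -EFinB ltry.
exists (fine (mu B)); first by rewrite fineK.
move=> k k0.
have [|_ [E1 [e1 E1B] <-] h1] := @ub_ereal_sup_adherent R
    [set mu E | E in [set E : set R | elementary_set E /\ E `<=` B]] k k0.
  by rewrite -/(inner_jordan_content B) iE.
have [|_ [E2 [e2 E2B] <-] h2] := @lb_ereal_inf_adherent R
    [set mu E | E in [set E : set R | elementary_set E /\ B `<=` E]] k k0.
  by rewrite -/(outer_jordan_content B) oB.
exists E1, E2; split => //.
- by move: h1; rewrite -/(inner_jordan_content B) iE EFinB fineK// => /ltW.
- by move: h2; rewrite -/(outer_jordan_content B) oB EFinD fineK// => /ltW.
Qed.

Lemma measure_le_setD (A B : set (measurableTypeR R)) (v k : R) :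
    measurable A -> measurable B ->
    (mu B <= v%:E)%E -> (mu (A `\` B) <= k%:E)%E ->
  (mu A <= (v + k)%:E)%E.
Proof.
move=> mA mB Bv ABk; apply: (@le_trans _ _ (mu (B `|` (A `\` B)))).
  by apply: lebesgue_measure_le => x Ax; have [Bx|nBx] := pselect (B x); [left|right].
apply: le_trans (measureU2 _ _ _) _; [exact: mB|exact: measurableD|].
by rewrite EFinD; exact: leeD.
Qed.

Section Transfer.
Variables (M : nat -> nat) (S : nat -> nat -> R) (A : nat -> R) (F : nat -> R -> R).
Hypothesis M0 : forall n, (0 < M n)%N.
Hypothesis A0 : forall n, 0 <= A n.
Hypothesis heat_limit : forall s r e : R, 0 < s -> 0 < e ->
  \forall n \near \oo, forall x, `|x| <= r ->
    `|A n * mean (M n) (fun j => heat_kernel s (S n j - x)) - 1| <= e.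
Hypothesis close : forall d : R, 0 < d ->
  \forall n \near \oo, forall j x, cell (M n) j x -> `|F n x - S n j| < d.

(** Half of each margin absorbs the distance between F n x and S n j, the other
    half smooths the indicator. *)
Lemma local_limit_transfer (B : set R) : bounded_set B -> jordan_measurable B ->
  ((A n)%:E * mu [set x : R | x \in `[0%R, 1%R] /\ B (F n x)])%E
    @[n --> \oo] --> ((Num.sqrt (2 * pi))^-1%:E * mu B)%E.
Proof.
move=> bB jB; have [v vE approx] := jordan_approximation bB jB.
pose Q n := mu [set x : R | x \in `[0%R, 1%R] /\ B (F n x)].
have Q0 n : (0 <= Q n)%E.
  by rewrite -(measure0 mu); apply: lebesgue_measure_le.
have Qf n : Q n \is a fin_num.
  rewrite ge0_fin_numE//; apply: (@le_lt_trans _ _ (mu `[0, 1]%classic)).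
    by apply: lebesgue_measure_le => x [].
  by rewrite lebesgue_measure_itv/= lte01 oppr0 adde0 ltry.
pose p : R := Num.sqrt (2 * pi).
have p1 : 1 <= p.
  rewrite -[leLHS]sqrtr1 ler_wsqrtr//; have := pi_ge2 R; lra.
have p0 : 0 < p by lra.
have ip1 : p^-1 <= 1 by rewrite invf_le1.
have ip0 : 0 < p^-1 by rewrite invr_gt0.
rewrite (_ : (fun n => _) = (fun n => (A n * fine (Q n))%:E)); last first.
  by apply/funext => n; rewrite EFinM fineK.
rewrite vE -EFinM; apply: cvg_EFin; first exact: nearW.
apply/cvgrPdist_le => /= e e0.
pose k := e / 3; have k0 : 0 < k by rewrite divr_gt0.
have [E1 [E2 [[el1 el2] E1B BE2 E1v E2v]]] := approx k k0.
have [mE1 [C1 [C2 [d1 [r1 [d10 [mC1 _ C2r [C1E E1C2] [E1C _]]]]]]]] :=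
  elementary_margin el1 k0.
have [mE2 [D1 [D2 [d2 [r2 [d20 [_ mD2 D2r [_ E2D] [_ DE2]]]]]]]] :=
  elementary_margin el2 k0.
have D2v : fine (mu D2) <= v + k + k.
  have h := measure_le_setD mD2 mE2 E2v DE2.
  rewrite -lee_fin fineK// ge0_fin_numE; first exact: le_lt_trans h (ltry _).
  by rewrite -(measure0 mu); apply: lebesgue_measure_le.
have C1r x : C1 x -> `|x| <= r1.
  move=> C1x; apply/C2r/(E1C2 x); last by rewrite subrr normr0.
  by apply: (C1E x) => //; rewrite subrr normr0.
have C1v : v - k <= fine (mu C1) + k.
  have C1f : mu C1 \is a fin_num.
    rewrite ge0_fin_numE; last by rewrite -(measure0 mu); apply: lebesgue_measure_le.
    apply: (@le_lt_trans _ _ (mu `[- r1, r1]%classic)).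
      by apply: lebesgue_measure_le => x /C1r; rewrite /= in_itv/= ler_norml.
    by rewrite lebesgue_measure_itv/=; case: ifPn => // _; rewrite -EFinB ltry.
  rewrite -lee_fin; apply: le_trans E1v _.
  by apply: (measure_le_setD mE1 mC1) => //; rewrite fineK.
pose d := Num.min d1 d2 / 2.
have d12 : 0 < Num.min d1 d2 by rewrite lt_min d10.
have d0 : 0 < d by rewrite divr_gt0.
have dd1 : d + d <= d1 by rewrite -splitr ge_min lexx.
have dd2 : d + d <= d2 by rewrite -splitr ge_min lexx orbT.
(* G1 and G2 shrink E1 and enlarge E2 by d, so that a digit sum in G1 puts
   F n x in E1, and F n x in E2 puts the digit sum in G2. *)
pose G1 := [set y : R | forall z, `|z - y| < d -> E1 z].
pose G2 := [set y : R | exists2 z, E2 z & `|z - y| < d].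
have lo := count_liminf (E := G1) A0 heat_limit d0 k0 mC1 C1r.
have up := count_limsup (E := G2) A0 heat_limit d0 k0 mD2 D2r.
have {}lo : \forall n \near \oo, fine (mu C1) / p - k
    <= A n * mean (M n) (fun j => \1_G1 (S n j)).
  apply: lo => y x C1x yx z zy; apply: (C1E x) => //.
  by rewrite -(subrKA y); apply: le_lt_trans (ler_normD _ _) _; lra.
have {}up : \forall n \near \oo, A n * mean (M n) (fun j => \1_G2 (S n j))
    <= fine (mu D2) / p + k.
  apply: up => y x [z E2z zy] yx; apply: (E2D z) => //.
  rewrite -(subrKA y); apply: le_lt_trans (ler_normD _ _) _.
  by rewrite distrC [`|y - z|]distrC; lra.
near=> n.
have ln : fine (mu C1) / p - k <= A n * mean (M n) (fun j => \1_G1 (S n j)).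
  by near: n.
have un : A n * mean (M n) (fun j => \1_G2 (S n j)) <= fine (mu D2) / p + k.
  by near: n.
have cn : forall j x, cell (M n) j x -> `|F n x - S n j| < d.
  by near: n; exact: close.
have Qu : fine (Q n) <= mean (M n) (fun j => \1_G2 (S n j)).
  rewrite -lee_fin fineK//; apply: le_measure_cells => // j x _ cx /BE2 E2x.
  by exists (F n x) => //; exact: cn.
have Ql : mean (M n) (fun j => \1_G1 (S n j)) <= fine (Q n).
  rewrite -lee_fin fineK//; apply: ge_measure_cells => // j x _ cx G1j.
  by apply/E1B/G1j; exact: cn.
have := ler_wpM2l (A0 n) Qu; have := ler_wpM2l (A0 n) Ql.
move: ln un; set y1 := A n * mean _ _; set y2 := A n * mean _ _; set y := A n * fine _.
move=> ln un h1 h2.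
have h3 : fine (mu D2) / p <= (v + k + k) / p by rewrite ler_wpM2r// ltW.
have h4 : (v - k - k) / p <= fine (mu C1) / p by rewrite ler_wpM2r ?(ltW ip0)//; lra.
have h5 : k / p <= k by rewrite ler_piMr// ltW.
have ke : e = k + k + k by rewrite /k; field.
rewrite !mulrDl ?mulrBl in h3 h4; rewrite mulrC ler_norml ke.
by apply/andP; split; lra.
Unshelve. all: by end_near.
Qed.

End Transfer.
End Jordan.

(** * The lacunary array *)

Lemma gap_ratio_digits (R : realType) (m : nat -> nat) :
    (forall k, (1 <= k)%N -> (0 < m k)%N) ->
    (forall k, (1 <= k)%N -> exists2 q : nat, (2 <= q)%N & gap_ratio R m k = q%:R) ->
  exists b : nat -> nat, forall k, (1 <= k)%N ->
    [/\ (0 < b k)%N, m k.+1 = (m k * b k)%N & gap_ratio R m k = (b k)%:R].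
Proof.
move=> m0 bq; exists (fun k => m k.+1 %/ m k)%N => k k1.
have [q q2 qE] := bq k k1; have mk := m0 k k1.
have mE : m k.+1 = (q * m k)%N.
  apply/eqP; rewrite -(eqr_nat R) natrM -qE /gap_ratio divfK//.
  by rewrite pnatr_eq0 -lt0n.
by rewrite mE mulnK// mulnC qE; split => //; apply: leq_trans q2.
Qed.

Section Array.
Variables (R : realType) (f : R -> R) (h alpha : R) (m b : nat -> nat)
  (a : nat -> nat -> R).
Hypothesis f_per : forall x, f (x + 1) = f x.
Hypothesis alpha_gt0 : 0 < alpha.
Hypothesis f_holder : forall x y : R, x <> y -> `|f x - f y| <= h * `|x - y| `^ alpha.
Hypothesis f_mean : \int[lebesgue_measure]_(x in `[0%R, 1%R]) f x = 0.
Hypothesis f_var : \int[lebesgue_measure]_(x in `[0%R, 1%R]) (f x ^+ 2) = 1.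
Hypothesis m_gt0 : forall k, (1 <= k)%N -> (0 < m k)%N.
Hypothesis b_gt0 : forall k, (1 <= k)%N -> (0 < b k)%N.
Hypothesis m_rec : forall k, (1 <= k)%N -> m k.+1 = (m k * b k)%N.
Hypothesis A_infty : array_norm a n @[n --> \oo] --> +oo.
Hypothesis a_cube : \sum_(1 <= k < n.+1) `|a k n| ^+ 3 @[n --> \oo] --> (0 : R).
Hypothesis a_gap : array_norm a n * (\sum_(1 <= k < n.+1) `|a k n| / (b k)%:R `^ alpha)
  @[n --> \oo] --> (0 : R).

Let digits n k d := a k n * centered_digit f (b k) d.
Let gaps n : R := \sum_(1 <= k < n.+1) `|a k n| * holder_gap h alpha (b k).

(** As A_n >= 1 eventually, this is weaker than the hypothesis on the gaps. *)
Lemma gaps_to0 (e : R) : 0 < e -> \forall n \near \oo, gaps n <= e.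
Proof.
move=> e0; have h0 := holder_cst_ge0 f_holder.
have h1 : 0 < h + 1 by rewrite ltr_wpDl.
have eh : 0 < e / (h + 1) by rewrite divr_gt0.
near=> n.
have A1 : 1 <= array_norm a n by near: n; move/cvgryPge : A_infty; exact.
have : array_norm a n * (\sum_(1 <= k < n.+1) `|a k n| / (b k)%:R `^ alpha) <= e / (h + 1).
  near: n; move/cvgrPdist_le : a_gap => /(_ _ eh); apply: filterS => n.
  by rewrite sub0r normrN; apply: le_trans; exact: ler_norm.
have -> : gaps n = h * \sum_(1 <= k < n.+1) `|a k n| / (b k)%:R `^ alpha.
  by rewrite mulr_sumr; apply: eq_bigr => k _; rewrite /holder_gap; ring.
set s := \sum_(_ <= _ < _) _ => As.
have s0 : 0 <= s by apply: sumr_ge0 => k _; rewrite divr_ge0 ?powR_ge0.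
have : s * (h + 1) <= e.
  by rewrite -ler_pdivlMr//; apply: le_trans As; rewrite ler_peMl.
by lra.
Unshelve. all: by end_near.
Qed.

(** Each term is off by a_k^2 times a multiple of the Hoelder gap, and
    a_k^2 <= |a_k| eventually, because the cubes sum to at most 1. *)
Lemma digit_var_array_norm : digit_var b (digits n) n - array_norm a n ^+ 2
  @[n --> \oo] --> (0 : R).
Proof.
have h0 := holder_cst_ge0 f_holder.
pose K : R := 3 * (`|f 0| + h).
have K0 : 0 <= K by rewrite mulr_ge0// addr_ge0.
apply/cvgrPdist_le => /= e e0.
have K1 : 0 < K + 1 by rewrite ltr_wpDl.
have eK : 0 < e / (K + 1) by rewrite divr_gt0.
near=> n.
have g1 : gaps n <= e / (K + 1) by near: n; exact: gaps_to0.
have a1 : \sum_(1 <= k < n.+1) `|a k n| ^+ 3 <= 1.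
  near: n; move/cvgrPdist_le : a_cube => /(_ _ ltr01); apply: filterS => n.
  by rewrite sub0r normrN; apply: le_trans; exact: ler_norm.
have g0 : 0 <= gaps n.
  by apply: sumr_ge0 => k _; rewrite mulr_ge0// (holder_gap_ge0 f_holder).
rewrite sub0r normrN; apply: (@le_trans _ _ (K * gaps n)); last first.
  have : gaps n * (K + 1) <= e by rewrite -ler_pdivlMr.
  by lra.
rewrite /array_norm sqr_sqrtr; last by apply: sumr_ge0 => k _; exact: sqr_ge0.
rewrite /digit_var -sumrB mulr_sumr; apply: le_trans (ler_norm_sum _ _ _) _.
rewrite [leLHS]big_nat [leRHS]big_nat; apply: ler_sum => k /andP[k1 kn].
have b0 := b_gt0 k1.
have ak : `|a k n| <= 1.
  have := @nat_sum_term_le R n k (fun k => `|a k n| ^+ 3).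
  rewrite k1 -ltnS kn => /(_ (fun i => exprn_ge0 3 (normr_ge0 _)) isT) ak.
  by rewrite -(@expr_le1 _ 3)//; apply: le_trans a1.
have -> : mean (b k) (fun d => digits n k d ^+ 2) - a k n ^+ 2 =
    a k n ^+ 2 * (mean (b k) (fun d => centered_digit f (b k) d ^+ 2) - 1).
  rewrite mulrBr mulr1 -meanZ; congr (_ - _); apply: eq_mean => d _.
  by rewrite /digits exprMn.
have v1 := centered_digit_var alpha_gt0 f_holder f_mean f_var b0.
rewrite normrM normrX expr2.
have -> : K * (`|a k n| * holder_gap h alpha (b k)) =
  `|a k n| * (K * holder_gap h alpha (b k)) by ring.
rewrite -mulrA ler_wpM2l//; apply: le_trans v1; rewrite -[leRHS]mul1r.
by rewrite ler_wpM2r.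
Unshelve. all: by end_near.
Qed.

Lemma lacunary_local_limit (B : set R) : bounded_set B -> jordan_measurable B ->
  ((array_norm a n)%:E * lebesgue_measure
     [set x : R | x \in `[0%R, 1%R] /\ B (lacunary_sum f m a n x)])%E
    @[n --> \oo] --> ((Num.sqrt (2 * pi))^-1%:E * lebesgue_measure B)%E.
Proof.
move=> bB jB.
(* Digits are numbered from 1, so that n of them determine a cell of mesh
   1 / m_(n+1). *)
apply: (@local_limit_transfer R (fun n => m n.+1)
  (fun n => digit_sum b (digits n) n)) => //.
- by move=> n; exact: m_gt0.
- by move=> n; exact: sqrtr_ge0.
- apply: (@local_limit_heat_kernel R (fun n => m n.+1) b
    (fun k => centered_digit f (b k)) a (2 * (`|f 0| + h))) => //.
  + exact: m_gt0.
  + by move=> k; exact: m_rec.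
  + move=> k k1; have b0 := b_gt0 k1; split => //.
    * exact: centered_digit_mean0.
    * by move=> d; apply: (centered_digit_bounded alpha_gt0 f_holder b0).
  + exact: digit_var_array_norm.
- move=> d d0; have d3 : 0 < d / 3 by rewrite divr_gt0.
  have := gaps_to0 d3; apply: filterS => n gn j x cx.
  have := cell_digit_sum alpha_gt0 f_holder f_mean f_per (fun k => a k n)
    (fun k k1 => conj (m_gt0 k1) (b_gt0 k1)) m_rec cx.
  move/le_lt_trans; apply.
  rewrite (_ : \sum_(_ <= _ < _) _ = 2 * gaps n); first lra.
  by rewrite mulr_sumr; apply: eq_bigr => k _; ring.
Qed.

End Array.

Theorem theorem2p16 (R : realType) (f : R -> R) (h alpha : R)
    (m : nat -> nat) (a : nat -> nat -> R)
    (f_meas : measurable_fun (`[0, 1[%classic : set R) f)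
    (f_per : forall x : R, f (x + 1) = f x)
    (alpha_gt0 : 0 < alpha)
    (f_holder : forall x y : R, x <> y ->
       `|f x - f y| <= h * `|x - y| `^ alpha)
    (f_mean : (\int[lebesgue_measure]_(x in `[0%R, 1%R]) (f x)%:E = 0)%E)
    (f_var : (\int[lebesgue_measure]_(x in `[0%R, 1%R]) (f x ^+ 2)%:E = 1)%E)
    (m_gt0 : forall k : nat, (1 <= k)%N -> (0 < m k)%N)
    (m_incr : forall k l : nat, (1 <= k)%N -> (k < l)%N -> (m k < m l)%N)
    (b_int : forall k : nat, (1 <= k)%N ->
       exists2 q : nat, (2 <= q)%N & gap_ratio R m k = q%:R)
    (b_infty : gap_ratio R m k @[k --> \oo] --> +oo)
    (A_infty : array_norm a n @[n --> \oo] --> +oo)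
    (a_cube : \sum_(1 <= k < n.+1) `|a k n| ^+ 3 @[n --> \oo] --> (0 : R))
    (a_gap : array_norm a n
               * (\sum_(1 <= k < n.+1) `|a k n| / gap_ratio R m k `^ alpha)
             @[n --> \oo] --> (0 : R)) :
  forall B : set R, bounded_set B -> jordan_measurable B ->
    ((array_norm a n)%:E * lebesgue_measure
       [set x : R | x \in `[0%R, 1%R] /\ B (lacunary_sum f m a n x)])%E
      @[n --> \oo]
    --> ((Num.sqrt (2 * pi))^-1%:E * lebesgue_measure B)%E.
Proof.
move=> B bB jB; have [b bE] := gap_ratio_digits m_gt0 b_int.
apply: (@lacunary_local_limit R f h alpha m b a) => //.
- by rewrite /Rintegral f_mean.
- by rewrite /Rintegral f_var.
- by move=> k /bE[].
- by move=> k /bE[].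
- rewrite (_ : (fun n => _) = (fun n => array_norm a n
      * (\sum_(1 <= k < n.+1) `|a k n| / gap_ratio R m k `^ alpha)))//.
  apply/funext => n; congr (_ * _); apply: eq_big_nat => k /andP[k1 _].
  by have [_ _ ->] := bE k k1.
Qed.
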